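(* In the Gaussian market model described in the context (with risk aversion $\rho=1$), the following hold. (1) There exists a unique decomposition $$\Lambda=\hat Q^{-1}+\hat\Gamma,\qquad \hat Q\succ0,\quad \hat Q\in\mathcal D^\perp,\quad \hat\Gamma\in\mathcal D .$$ (2) The maximizer $\hat\gamma$ of the optimization problem $$\max_{\gamma\in\mathcal A}\ \mathbb E_{\mathbb P}\big[-\exp(-V^\gamma)\big]$$ exists, is unique, and lies in $\mathcal A_l$; its terminal wealth is $$V^{\hat\gamma}=-\tfrac12\,Z\hat\Gamma Z^\top .$$ (3) The corresponding value is $$\mathbb E_{\mathbb P}\big[-\exp(-V^{\hat\gamma})\big]=-\sqrt{\frac{\det(\hat Q)}{\det(\Sigma)}} .$$
   Context: Model. Let $N\in\mathbb N$ and, for $i=1,\dots,N$, let $p_i,q_i\in\mathbb N$ with $q_i\ge p_i$. At time $i$ there are real random variables $X^i_1,\dots,X^i_{q_i}$; the first $p_i$ are increments of tradable assets, the others are increments of non-tradable factors. Let $n=\sum_{i=1}^Nq_i$ and assume that the random row vector $Z=(Z_1,\dots,Z_n):=(X^1_1,\dots,X^1_{q_1},\dots,X^N_1,\dots,X^N_{q_N})$ is, under the probability measure $\mathbb P$, multivariate normal with mean zero and positive definite covariance matrix $\Sigma$; set $\Lambda=\Sigma^{-1}$. Information. For each $i$ the information available for trading at time $i$ is generated by the random row vector $Y^i=(Y^i_1,\dots,Y^i_{m_i})=(X^1_1,\dots,X^1_{q_1},\dots,X^{i-1}_1,\dots,X^{i-1}_{q_{i-1}})A^i$, where $m_i\le\sum_{j=1}^{i-1}q_j$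 and $A^i$ is a deterministic matrix of size $(\sum_{j<i}q_j)\times m_i$ (for $i=1$ the vector $Y^1$ is empty, so time-1 positions are deterministic constants). Strategies. A trading strategy is a random vector $\gamma=(\gamma^i_j)_{1\le i\le N,\,1\le j\le p_i}$ with $\gamma^i_j=g^i_j(Y^i)$ for measurable $g^i_j:\mathbb R^{m_i}\to\mathbb R$. Its terminal portfolio value is $V^\gamma=\sum_{i=1}^N\sum_{j=1}^{p_i}\gamma^i_jX^i_j$. $\mathcal A$ is the set of all trading strategies $\gamma$ for which $V^\gamma$ is integrable under every centered nondegenerate Gaussian law of $Z$. $\mathcal A_l\subset\mathcal A$ is the set of strategies for which all functions $g^i_j$ can be taken linear (with $g^i_j(0)=0$). Strategies are random vectors, identified when equal almost surely. Subspace. For $i=1,\dots,N$, $j=1,\dots,p_i$, $k=1,\dots,m_i$, let $D^{i,j,k}$ be the unique real symmetric $n\times n$ matrix such that $Y^i_kX^i_j=-\frac12ZD^{i,j,k}Z^\top$ (as quadratic forms in $Z$). $\mathcal D$ is the linear span of all matrices $D^{i,j,k}$ in the space of real symmetric $n\times n$ matrices, and $\mathcal D^\perp$ is the set of real symmetric $n\times n$ matrices $Q$ with $\operatorname{tr}(QX)=0$ for all $X\in\mathcal D$. $\hat Q\succ0$ means that $\hat Q$ is symmetric positive definite. *)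

(* Defs.v *)
From HB Require Import structures.
From mathcomp Require Import all_boot all_order all_algebra.
From mathcomp Require Import all_classical all_reals all_analysis.

Set Implicit Arguments.
Unset Strict Implicit.
Unset Printing Implicit Defensive.

Import Order.TTheory GRing.Theory Num.Theory.
Import numFieldNormedType.Exports.

Local Open Scope classical_set_scope.
Local Open Scope ring_scope.

(** * Centered nondegenerate Gaussian laws on R^n

    R^n is [n.-tuple R], whose sigma-algebra (generated by the coordinates) is
    the Borel one; linear algebra is done on the associated row vectors. *)

Definition row_of_tuple (R : realType) (n : nat) (z : n.-tuple R) : 'rV[R]_n :=
  \row_k tnth z k.

Definition tuple_of_row (R : realType) (n : nat) (v : 'rV[R]_n) : n.-tuple R :=
  [tuple v 0 k | k < n].

Definition quadform (R : realType) (n : nat) (S : 'M[R]_n) (v : 'rV[R]_n) : R :=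
  (v *m S *m v^T) 0 0.

Definition symmx (R : realType) (n : nat) (S : 'M[R]_n) : Prop := S^T = S.

Definition posdefmx (R : realType) (n : nat) (S : 'M[R]_n) : Prop :=
  symmx S /\ forall v : 'rV[R]_n, v != 0 -> 0 < quadform S v.

Lemma quadform_eq0 (R : realType) (n : nat) (E : 'M[R]_n) :
  symmx E -> (forall v, quadform E v = 0) -> E = 0.
Proof.
rewrite /quadform => Esym E0; apply/matrixP => a b; rewrite [RHS]mxE.
have addE (A B : 'M[R]_1) : (A + B) 0 0 = A 0 0 + B 0 0 by rewrite mxE.
have ent a' b' : ((delta_mx 0 a' : 'rV_n) *m E *m (delta_mx 0 b' : 'rV_n)^T)
    0 0 = E a' b'.
  by rewrite -rowE trmx_delta -colE !mxE.
have := E0 (delta_mx 0 a + delta_mx 0 b).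
rewrite mulmxDl linearD /= !mulmxDr !mulmxDl !addE !ent.
have -> : E b a = E a b by rewrite -[in LHS]Esym mxE.
have -> : E a a = 0 by rewrite -ent E0.
have -> : E b b = 0 by rewrite -ent E0.
rewrite add0r addr0 -mulr2n => /eqP; rewrite mulrn_eq0 /=.
by move=> /eqP.
Qed.

Lemma quadform_inj (R : realType) (n : nat) (A B : 'M[R]_n) :
  symmx A -> symmx B -> (forall v, quadform A v = quadform B v) -> A = B.
Proof.
move=> As Bs AB; apply/eqP; rewrite -subr_eq0; apply/eqP/quadform_eq0 => [|v].
  by rewrite /symmx linearB /= As Bs.
have := AB v; rewrite /quadform mulmxBr mulmxBl => h.
by rewrite [LHS]mxE [X in _ + X]mxE h subrr.
Qed.

(** Iterated Lebesgue integral
    [int ... int f(z_1, ..., z_n) dz_n ... dz_1]; by Tonelli's theorem this is,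
    for nonnegative measurable [f], the integral of [f] against the
    n-dimensional Lebesgue measure. *)
Fixpoint lebesgue_iterint (R : realType) (n : nat) :
    (n.-tuple R -> \bar R) -> \bar R :=
  match n with
  | 0 => fun f => f [tuple]
  | k.+1 => fun f =>
      (\int[lebesgue_measure]_x
         lebesgue_iterint (fun t : k.-tuple R => f [tuple of x :: t]))%E
  end.

Definition gauss_pdf (R : realType) (n : nat) (S : 'M[R]_n) (z : n.-tuple R)
    : R :=
  (Num.sqrt ((2 * pi) ^+ n * \det S))^-1 *
  expR (- (2^-1 * quadform (invmx S) (row_of_tuple z))).

(** [mu] is the normal law with mean 0 and covariance matrix [S]
    (meaningful for positive definite [S]). *)
Definition gauss_law (R : realType) (n : nat) (S : 'M[R]_n)
    (mu : set (n.-tuple R) -> \bar R) : Prop :=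
  forall B : set (n.-tuple R), measurable B ->
    mu B = lebesgue_iterint (fun z => (\1_B z * gauss_pdf S z)%:E).

(** * The market *)

(** Times are numbered from 0: [i : 'I_horizon] is the time i + 1.
    [nasset], [nvar] and [ninfo] are the families p, q and m. *)
Record market (R : realType) := Market {
  horizon : nat;
  nasset : 'I_horizon -> nat;
  nvar : 'I_horizon -> nat;
  nasset_le : forall i, (nasset i <= nvar i)%N;
  ninfo : 'I_horizon -> nat;
  ninfo_le : forall i, (ninfo i <= \sum_(j < horizon | (j < i)%N) nvar j)%N;
  infomx : forall i : 'I_horizon,
    'M[R]_((\sum_(j < horizon | (j < i)%N) nvar j)%N, ninfo i)
}.

Arguments nasset {R} m i : rename.
Arguments nvar {R} m i : rename.
Arguments ninfo {R} m i : rename.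
Arguments infomx {R} m i : rename.

(** n and the number of variables strictly before time [i]. *)
Notation nvars M := (\sum_(i < horizon M) nvar M i)%N.
Notation npast M i := (\sum_(j < horizon M | (j < i)%N) nvar M j)%N.

Lemma npast_le (R : realType) (M : market R) (i : 'I_(horizon M)) :
  (npast M i <= nvars M)%N.
Proof.
by rewrite [leqRHS](bigID (fun j : 'I_(horizon M) => (j < i)%N)) /= leq_addr.
Qed.

(** Position in Z of the [j]-th asset increment of time [i].  [tagnat.Rank] is
    the lexicographic numbering: see [tagnat.RankEsum]. *)
Definition asset_pos (R : realType) (M : market R) (i : 'I_(horizon M))
    (j : 'I_(nasset M i)) : 'I_(nvars M) :=
  tagnat.Rank i (widen_ord (nasset_le i) j).

(** In the next definitions [z] is a value of Z; the variables of the times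
    before [i] are the first [npast M i] coordinates. *)
Definition past (R : realType) (M : market R) (i : 'I_(horizon M))
    (z : (nvars M).-tuple R) : 'rV[R]_(npast M i) :=
  \row_l tnth z (widen_ord (npast_le i) l).

Definition info (R : realType) (M : market R) (i : 'I_(horizon M))
    (z : (nvars M).-tuple R) : (ninfo M i).-tuple R :=
  tuple_of_row (past i z *m infomx M i).

Definition feedback (R : realType) (M : market R) : Type :=
  forall i : 'I_(horizon M), 'I_(nasset M i) -> (ninfo M i).-tuple R -> R.

Definition feedback_wealth (R : realType) (M : market R) (g : feedback M)
    (z : (nvars M).-tuple R) : R :=
  \sum_(i < horizon M) \sum_(j < nasset M i)
    g i j (info i z) * tnth z (asset_pos j).

Definition measurable_feedback (R : realType) (M : market R) (g : feedback M)
    : Prop :=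
  forall i (j : 'I_(nasset M i)), measurable_fun setT (g i j).

Definition linear_feedback (R : realType) (M : market R) (g : feedback M)
    : Prop :=
  forall i (j : 'I_(nasset M i)), exists c : 'I_(ninfo M i) -> R,
    forall y, g i j y = \sum_(k < ninfo M i) c k * tnth y k.

(** The quantification is over laws on the space of values of Z. *)
Definition integrable_feedback (R : realType) (M : market R) (g : feedback M)
    : Prop :=
  forall (S : 'M[R]_(nvars M)) (mu : probability ((nvars M).-tuple R) R),
    posdefmx S -> gauss_law S mu ->
    mu.-integrable setT (EFin \o feedback_wealth g).

(** * Random variables and trading strategies *)

Definition factors (R : realType) (M : market R) (d : measure_display)
    (T : measurableType d) (P : probability T R) : Type :=
  forall i : 'I_(horizon M), 'I_(nvar M i) -> {RV P >-> R}.

Section strategies.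
Context (R : realType) (M : market R) (d : measure_display)
  (T : measurableType d) (P : probability T R).
Variable X : factors M P.

Definition Zvec (w : T) : (nvars M).-tuple R :=
  [tuple X (tagnat.sig2 k) w | k < nvars M].

Definition Yvec (i : 'I_(horizon M)) (w : T) : (ninfo M i).-tuple R :=
  info i (Zvec w).

Definition strategy : Type :=
  forall i : 'I_(horizon M), 'I_(nasset M i) -> T -> R.

Definition wealth (gam : strategy) (w : T) : R :=
  \sum_(i < horizon M) \sum_(j < nasset M i)
    gam i j w * X (widen_ord (nasset_le i) j) w.

Definition generated_by (g : feedback M) (gam : strategy) : Prop :=
  forall i (j : 'I_(nasset M i)) w, gam i j w = g i j (Yvec i w).

Definition admissible (gam : strategy) : Prop :=
  exists g : feedback M,
    [/\ measurable_feedback g, generated_by g gam & integrable_feedback g].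

Definition linear_admissible (gam : strategy) : Prop :=
  admissible gam /\
  exists g : feedback M, linear_feedback g /\ generated_by g gam.

Definition ae_eq_strategy (gam gam' : strategy) : Prop :=
  forall i (j : 'I_(nasset M i)), {ae P, forall w, gam i j w = gam' i j w}.

Definition utility (gam : strategy) : \bar R :=
  'E_P[fun w => - expR (- wealth gam w)].

Definition maximizer (gam : strategy) : Prop :=
  admissible gam /\
  forall gam', admissible gam' -> (utility gam' <= utility gam)%E.

Lemma tnth_Zvec (i : 'I_(horizon M)) (j : 'I_(nvar M i)) w :
  tnth (Zvec w) (tagnat.Rank i j) = X j w.
Proof.
rewrite tnth_mktuple /tagnat.sig2 /tagnat.sig1 /tagnat.Rank.
by rewrite tagnat.rankK.
Qed.

Lemma wealth_feedback (g : feedback M) (gam : strategy) :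
  generated_by g gam -> forall w, wealth gam w = feedback_wealth g (Zvec w).
Proof.
move=> gg w; apply: eq_bigr => i _; apply: eq_bigr => j _.
by rewrite gg tnth_Zvec.
Qed.

End strategies.

(** * The subspace spanned by the matrices D^{i,j,k} *)

(** The column of coefficients of Y^i_k as a linear form in Z. *)
Definition info_coef (R : realType) (M : market R) (i : 'I_(horizon M))
    (k : 'I_(ninfo M i)) : 'cV[R]_(nvars M) :=
  \col_l \sum_(h < npast M i | val h == val l) infomx M i h k.

Definition Dmx (R : realType) (M : market R) (i : 'I_(horizon M))
    (j : 'I_(nasset M i)) (k : 'I_(ninfo M i)) : 'M[R]_(nvars M) :=
  - (info_coef k *m delta_mx 0 (asset_pos j) +
     delta_mx (asset_pos j) 0 *m (info_coef k)^T).

Lemma Dmx_sym (R : realType) (M : market R) (i : 'I_(horizon M))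
    (j : 'I_(nasset M i)) (k : 'I_(ninfo M i)) : symmx (Dmx j k).
Proof.
by rewrite /symmx /Dmx linearN linearD /= !trmx_mul trmxK !trmx_delta addrC.
Qed.

Lemma info_coefE (R : realType) (M : market R) (i : 'I_(horizon M))
    (k : 'I_(ninfo M i)) (z : (nvars M).-tuple R) :
  tnth (info i z) k = (row_of_tuple z *m info_coef k) 0 0.
Proof.
rewrite tnth_mktuple !mxE.
under [RHS]eq_bigr => l _ do rewrite !mxE big_distrr /=.
rewrite (exchange_big_dep xpredT) //=; apply: eq_bigr => h _.
by rewrite mxE (big_pred1 (widen_ord (npast_le i) h)).
Qed.

Lemma DmxE (R : realType) (M : market R) (i : 'I_(horizon M))
    (j : 'I_(nasset M i)) (k : 'I_(ninfo M i)) (z : (nvars M).-tuple R) :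
  tnth (info i z) k * tnth z (asset_pos j) =
  - (2^-1 * quadform (Dmx j k) (row_of_tuple z)).
Proof.
rewrite info_coefE /quadform /Dmx mulmxN mulNmx [in RHS]mxE mulrN opprK.
set v := row_of_tuple z; set a := info_coef k.
have vj : (v *m delta_mx (asset_pos j) (0 : 'I_1)) 0 0 = tnth z (asset_pos j).
  by rewrite -colE !mxE.
rewrite mulmxDr mulmxDl [in RHS]mxE !mulmxA.
have E1 : (v *m a *m delta_mx 0 (asset_pos j) *m v^T) 0 0 =
          (v *m a) 0 0 * tnth z (asset_pos j).
  rewrite -mulmxA -[delta_mx _ _ *m _]trmxK trmx_mul trmxK trmx_delta.
  by rewrite mxE big_ord1 [X in _ * X]mxE vj.
have E2 : (v *m delta_mx (asset_pos j) 0 *m a^T *m v^T) 0 0 =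
          (v *m a) 0 0 * tnth z (asset_pos j).
  rewrite -mulmxA -trmx_mul mxE big_ord1 vj [X in _ * X]mxE.
  by rewrite mulrC.
by rewrite E1 E2 -mulr2n -(mulr_natl (_ * tnth z _)) mulKf.
Qed.

Lemma Dmx_unique (R : realType) (M : market R) (i : 'I_(horizon M))
    (j : 'I_(nasset M i)) (k : 'I_(ninfo M i)) (D : 'M[R]_(nvars M)) :
  symmx D ->
  (forall z : (nvars M).-tuple R, tnth (info i z) k * tnth z (asset_pos j) =
    - (2^-1 * quadform D (row_of_tuple z))) ->
  D = Dmx j k.
Proof.
move=> Dsym DE; apply: (quadform_inj Dsym (@Dmx_sym _ _ _ _ _)) => v.
have -> : v = row_of_tuple (tuple_of_row v).
  by apply/rowP => l; rewrite !mxE tnth_mktuple.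
have := DE (tuple_of_row v); rewrite DmxE => /oppr_inj/mulfI; move=> h.
by rewrite h // invr_eq0 pnatr_eq0.
Qed.

Definition Dspace (R : realType) (M : market R) : {vspace 'M[R]_(nvars M)} :=
  (\sum_(i < horizon M) \sum_(j < nasset M i) \sum_(k < ninfo M i)
     <[Dmx j k]>)%VS.

Definition Dperp (R : realType) (M : market R) (Q : 'M[R]_(nvars M)) : Prop :=
  symmx Q /\ forall D, D \in Dspace M -> \tr (Q *m D) = 0.

Definition decomposition (R : realType) (M : market R)
    (L Q G : 'M[R]_(nvars M)) : Prop :=
  [/\ L = invmx Q + G, posdefmx Q, Dperp Q & G \in Dspace M].

(* Main.v *)
Require Import Defs.
From HB Require Import structures.
From mathcomp Require Import all_boot all_order all_algebra.
From mathcomp Require Import all_classical all_reals all_analysis.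
From mathcomp Require Import measurable_realfun ring lra zify.
Set Implicit Arguments.
Unset Strict Implicit.
Unset Printing Implicit Defensive.
Import Order.TTheory GRing.Theory Num.Theory.
Import numFieldNormedType.Exports.

Local Open Scope classical_set_scope.
Local Open Scope ring_scope.

(** The decomposition: [det (invmx S - G)] is maximized over those [G] in
    [Dspace M] for which the matrix is positive semidefinite. This set is compact
    because every [G] in [Dspace M] has trace 0; a maximizer has nonzero
    determinant, so it is positive definite, and the first-order condition says
    that the inverse [Q] of the maximizing matrix lies in the orthogonal space.

    The optimization: let [Vh = - Z G Z^T / 2], the wealth of a linear strategy.
    Up to a constant, [exp (- Vh)] is the density of N(0, Q) with respect to
    N(0, S). Under N(0, Q) the multiplier and the increment of every term of a
    wealth are uncorrelated, hence every admissible [V] has mean 0, and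
    [exp (- (V - Vh)) >= 1 - (V - Vh)], with equality only for [V = Vh], gives the
    optimality of [Vh] and its uniqueness. Only the wealth as a whole is assumed
    integrable, under all Gaussian laws; its terms are recovered from the wealth
    under N(0, t I), where coordinates can be flipped, and N(0, t I) has up to a
    constant a larger density than N(0, Q) for [t] large. *)

(** * Positive definite matrices *)

Section bilinear_form.
Variables (R : realType) (n : nat).
Implicit Types (A B : 'M[R]_n) (u v w : 'rV[R]_n).

Definition bilform A u v : R := (u *m A *m v^T) 0 0.

Lemma quadformE A v : quadform A v = bilform A v v. Proof. by []. Qed.

Lemma bilformDl A u v w : bilform A (u + v) w = bilform A u w + bilform A v w.
Proof. by rewrite /bilform !mulmxDl mxE. Qed.

Lemma bilformDr A u v w : bilform A u (v + w) = bilform A u v + bilform A u w.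
Proof. by rewrite /bilform linearD /= mulmxDr mxE. Qed.

Lemma bilformZl A c u v : bilform A (c *: u) v = c * bilform A u v.
Proof. by rewrite /bilform -!scalemxAl mxE. Qed.

Lemma bilformZr A c u v : bilform A u (c *: v) = c * bilform A u v.
Proof. by rewrite /bilform linearZ /= -scalemxAr mxE. Qed.

Lemma bilformC A u v : symmx A -> bilform A u v = bilform A v u.
Proof.
move=> As; rewrite /bilform; transitivity ((u *m A *m v^T)^T 0 0).
  by rewrite [RHS]mxE.
by rewrite !trmx_mul trmxK As mulmxA.
Qed.

Lemma quadformDZ A u t v : symmx A ->
  quadform A (u + t *: v) =
  quadform A u + 2 * t * bilform A u v + t ^+ 2 * quadform A v.
Proof.
move=> As; rewrite !quadformE !(bilformDl, bilformDr, bilformZl, bilformZr).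
by rewrite (bilformC v u As); ring.
Qed.

Lemma quadformB A B v : quadform (A - B) v = quadform A v - quadform B v.
Proof. by rewrite /quadform mulmxBr mulmxBl mxE [X in _ + X]mxE. Qed.

Lemma quadformD A B v : quadform (A + B) v = quadform A v + quadform B v.
Proof. by rewrite /quadform mulmxDr mulmxDl mxE. Qed.

Lemma quadformZ A c v : quadform (c *: A) v = c * quadform A v.
Proof. by rewrite /quadform -scalemxAr -scalemxAl mxE. Qed.

Lemma bilform_delta A k l : bilform A (delta_mx 0 k) (delta_mx 0 l) = A k l.
Proof. by rewrite /bilform -rowE trmx_delta -colE !mxE. Qed.

Lemma bilform1E u v : bilform 1%:M u v = \sum_k u 0 k * v 0 k.
Proof. by rewrite /bilform mulmx1 mxE; apply: eq_bigr => k _; rewrite mxE. Qed.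

Lemma quadform1E v : quadform 1%:M v = \sum_k v 0 k ^+ 2.
Proof. by rewrite quadformE bilform1E; apply: eq_bigr => k _; rewrite expr2. Qed.

Lemma quadform1_ge0 v : 0 <= quadform 1%:M v.
Proof. by rewrite quadform1E sumr_ge0 // => k _; rewrite sqr_ge0. Qed.

Lemma quadform1_gt0 v : v != 0 -> 0 < quadform 1%:M v.
Proof.
move=> v0; rewrite lt_neqAle quadform1_ge0 andbT; apply: contra v0.
rewrite eq_sym quadform1E psumr_eq0 => [/allP h|k _]; last exact: sqr_ge0.
apply/eqP/rowP => k; rewrite mxE; apply/eqP.
by have := h k (mem_index_enum _); rewrite sqrf_eq0.
Qed.

Lemma quadform0 A : quadform A 0 = 0.
Proof. by rewrite /quadform !mul0mx mxE. Qed.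

Lemma sqr_le_quadform1 v k : v 0 k ^+ 2 <= quadform 1%:M v.
Proof.
rewrite quadform1E (bigD1 k) //= lerDl sumr_ge0 // => i _; exact: sqr_ge0.
Qed.

Lemma quadform_sumE A v : quadform A v = \sum_k \sum_l A k l * (v 0 k * v 0 l).
Proof.
rewrite /quadform mxE; under eq_bigr do rewrite mxE mulr_suml.
rewrite exchange_big; apply: eq_bigr => k _; apply: eq_bigr => l _.
by rewrite !mxE; ring.
Qed.

Lemma quadform_abs_le A v :
  `|quadform A v| <= (\sum_k \sum_l `|A k l|) * quadform 1%:M v.
Proof.
rewrite quadform_sumE mulr_suml (le_trans (ler_norm_sum _ _ _)) // ler_sum //.
move=> k _; rewrite mulr_suml (le_trans (ler_norm_sum _ _ _)) // ler_sum //.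
move=> l _; rewrite normrM ler_wpM2l //.
have := sqr_le_quadform1 v k; have := sqr_le_quadform1 v l.
have := sqr_ge0 (v 0 k - v 0 l); have := sqr_ge0 (v 0 k + v 0 l).
by rewrite ler_norml => *; apply/andP; split; nra.
Qed.

Lemma posdef1 : posdefmx (1%:M : 'M[R]_n).
Proof. by split; [exact: trmx1|exact: quadform1_gt0]. Qed.

Lemma posdef_ge0 A v : posdefmx A -> 0 <= quadform A v.
Proof.
move=> [_ Ap]; have [->|v0] := eqVneq v 0; first by rewrite quadform0.
exact/ltW/Ap.
Qed.

Lemma posdefZ A c : 0 < c -> posdefmx A -> posdefmx (c *: A).
Proof.
move=> c0 [As Ap]; split; first by rewrite /symmx linearZ /= As.
by move=> v v0; rewrite quadformZ mulr_gt0 // Ap.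
Qed.

(** Cauchy-Schwarz: the form is nonnegative at the component of [u] that is [A]-orthogonal to
    [v]. *)
Lemma bilform_sqr_le A u v : posdefmx A ->
  bilform A u v ^+ 2 <= quadform A u * quadform A v.
Proof.
move=> Ap; have [->|v0] := eqVneq v 0.
  rewrite quadform0 /bilform trmx0 mulmx0 mxE; lra.
have qv : 0 < quadform A v by case: Ap => _; apply.
set b := bilform A u v.
have := posdef_ge0 (u + (- (b / quadform A v)) *: v) Ap.
rewrite quadformDZ; last by case: Ap.
rewrite -/b => h; rewrite -subr_ge0.
have -> : quadform A u * quadform A v - b ^+ 2 = (quadform A u +
  2 * - (b / quadform A v) * b + (- (b / quadform A v)) ^+ 2 * quadform A v) *
  quadform A v by field; rewrite gt_eqF.
by rewrite mulr_ge0 // ltW.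
Qed.

Lemma posdef_unit A : posdefmx A -> A \in unitmx.
Proof.
move=> [_ Ap]; rewrite -row_free_unit -kermx_eq0.
apply/eqP/row_matrixP => i; rewrite row0; apply/eqP/negPn/negP => v0.
have := Ap _ v0; rewrite /quadform -row_mul mulmx_ker row0 mul0mx mxE.
by rewrite ltxx.
Qed.

Lemma symmx_inv A : symmx A -> symmx (invmx A).
Proof. by move=> As; rewrite /symmx trmx_inv As. Qed.

Lemma quadform_congr A (B : 'M[R]_n) v :
  quadform (B *m A *m B^T) v = quadform A (v *m B).
Proof. by rewrite /quadform trmx_mul !mulmxA. Qed.

Lemma posdef_inv A : posdefmx A -> posdefmx (invmx A).
Proof.
move=> Ap; have Au := posdef_unit Ap; have [As Apos] := Ap.
split=> [|v v0]; first exact: symmx_inv.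
have -> : invmx A = invmx A *m A *m (invmx A)^T.
  by rewrite mulVmx // mul1mx trmx_inv As.
rewrite quadform_congr; apply: Apos; apply: contra v0 => /eqP h.
by rewrite -[v](mulmxKV Au) h mul0mx.
Qed.

(** No eigenvalues are involved: [v 0 k] is the [A]-product of [v] with row [k] of [invmx A], so
    Cauchy-Schwarz bounds its square by a multiple of [quadform A v], and these bounds are summed
    over [k]. *)
Lemma posdef_coercive A : posdefmx A ->
  exists2 c, 0 < c & forall v, c * quadform 1%:M v <= quadform A v.
Proof.
move=> Ap; have Au := posdef_unit Ap; have As := Ap.1.
(* The summand 1 keeps [K] positive even in dimension 0. *)
pose K := 1 + \sum_k quadform A (delta_mx 0 k *m invmx A).
have K0 : 0 < K.
  by rewrite ltr_pwDl ?ltr01 // sumr_ge0 // => k _; exact: posdef_ge0.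
exists K^-1; first by rewrite invr_gt0.
move=> v; rewrite mulrC ler_pdivrMr // quadform1E /K mulrDr mulr1.
rewrite ler_wpDl ?posdef_ge0 // mulr_sumr ler_sum // => k _.
rewrite (le_trans _ (bilform_sqr_le _ _ Ap)) //.
suff -> : bilform A v (delta_mx 0 k *m invmx A) = v 0 k by [].
rewrite /bilform trmx_mul trmx_inv As mulmxA mulmxK // trmx_delta -colE.
by rewrite mxE.
Qed.

(** An isotropic [v] of a semidefinite form lies in its kernel: if [bilform A u v] were nonzero, the
    form would be affine and nonconstant in [t] along [u + t *: v], hence negative somewhere. *)
Lemma psd_unit_posdef A : symmx A -> (forall v, 0 <= quadform A v) ->
  A \in unitmx -> posdefmx A.
Proof.
move=> As A0 Au; split=> // v v0; rewrite lt_neqAle A0 andbT eq_sym.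
apply: contra v0 => /eqP qv.
suff h u : bilform A u v = 0.
  have vA : v *m A = 0.
    apply/rowP => k; rewrite [RHS]mxE -(h (delta_mx 0 k)) bilformC //.
    by rewrite /bilform trmx_delta -colE [RHS]mxE.
  by rewrite -[v](mulmxK Au) vA mul0mx.
apply/eqP/negPn/negP => b0.
(* The coefficient of [v] is chosen so that the form takes the value -1. *)
have := A0 (u + (- (quadform A u + 1) / (2 * bilform A u v)) *: v).
rewrite quadformDZ // qv mulr0 addr0.
have -> : 2 * (- (quadform A u + 1) / (2 * bilform A u v)) * bilform A u v =
  - (quadform A u + 1) by field.
lra.
Qed.

(** Nonnegativity at the sum and the difference of two basis vectors bounds twice the entry by two
    diagonal entries. This makes a set of semidefinite matrices of fixed trace bounded. *)
Lemma psd_entry_le A k l : symmx A -> (forall v, 0 <= quadform A v) ->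
  `|A k l| <= \tr A.
Proof.
move=> As A0.
have dge i : 0 <= A i i by rewrite -bilform_delta; exact: A0.
have dle i : A i i <= \tr A.
  by rewrite /mxtrace (bigD1 i) //= lerDl sumr_ge0.
have := A0 (delta_mx 0 k + 1 *: delta_mx 0 l).
have := A0 (delta_mx 0 k + (-1) *: delta_mx 0 l).
rewrite !quadformDZ // !quadformE !bilform_delta.
have := dle k; have := dle l => *.
by rewrite ler_norml; apply/andP; split; lra.
Qed.

End bilinear_form.

(** Block elimination with the lower right block as pivot: [s] is its Schur complement. Peeling off
    one coordinate in this way drives the inductions for the square-root factorization and for the
    Gaussian integral. *)
Lemma posdef_schur (R : realType) n (A : 'M[R]_(1 + n)) : posdefmx A ->
  exists s (b : 'rV[R]_n) (C : 'M[R]_n), [/\ 0 < s, posdefmx C &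
    A = block_mx 1%:M b 0 1%:M *m block_mx s%:M 0 0 C *m
        (block_mx 1%:M b 0 1%:M)^T].
Proof.
move=> [As Ap]; pose C := drsubmx A.
have Asub : A = block_mx (ulsubmx A) (ursubmx A) (ursubmx A)^T C.
  by rewrite -[LHS]submxK trmx_ursub As.
have Cs : symmx C by rewrite /symmx /C trmx_drsub As.
have Cp : posdefmx C.
  split=> // v v0; suff -> : quadform C v = quadform A (row_mx 0 v).
    apply: Ap; apply: contra v0 => /eqP/(congr1 rsubmx).
    by rewrite row_mxKr linear0 => ->.
  rewrite /quadform [in RHS]Asub tr_row_mx mul_row_block mul_row_col trmx0.
  by rewrite mulmx0 add0r mul0mx add0r.
have Cu := posdef_unit Cp.
pose b := ursubmx A *m invmx C.
pose s := (ulsubmx A - b *m C *m b^T) 0 0.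
have E : A = block_mx 1%:M b 0 1%:M *m block_mx s%:M 0 0 C *m
        (block_mx 1%:M b 0 1%:M)^T.
  rewrite tr_block_mx !mulmx_block !trmx1 trmx0.
  rewrite !(mulmx0, mul0mx, mulmx1, mul1mx, addr0, add0r) /s -mx11_scalar.
  rewrite subrK [LHS]Asub; congr block_mx; first by rewrite /b mulmxKV.
  by rewrite /b trmx_mul trmx_inv Cs mulmxA mulmxV // mul1mx.
exists s, b, C; split => //.
(* The left factor sends this row to the first basis vector, where the block diagonal form equals
   [s]; this gives the sign of [s]. *)
pose v : 'rV[R]_(1 + n) := row_mx 1%:M (- b).
have v0 : v != 0.
  apply/eqP => /(congr1 lsubmx); rewrite row_mxKl linear0 => /matrixP/(_ 0 0).
  by rewrite !mxE /= => /eqP; rewrite oner_eq0.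
have := Ap v v0.
rewrite E quadform_congr mul_row_block !(mulmx0, mulmx1, mul1mx, addr0) subrr.
rewrite /quadform mul_row_block !(mulmx0, mul0mx, addr0) tr_row_mx mul_row_col.
by rewrite trmx0 mulmx0 addr0 mul1mx trmx1 mulmx1 mxE mulr1n.
Qed.

Lemma posdef_cholesky (R : realType) n (A : 'M[R]_n) : posdefmx A ->
  exists N : 'M[R]_n, A = N *m N^T.
Proof.
elim: n A => [|n IH] A Ap; first by exists 0; apply/matrixP => -[].
have [s [b [C [s0 Cp ->]]]] := posdef_schur (Ap : posdefmx (A : 'M[R]_(1 + n))).
have [N ->] := IH C Cp.
have -> : block_mx s%:M 0 0 (N *m N^T) =
    block_mx (Num.sqrt s)%:M 0 0 N *m (block_mx (Num.sqrt s)%:M 0 0 N)^T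
    :> 'M[R]_(1 + n).
  rewrite tr_block_mx mulmx_block !trmx0 !(mulmx0, mul0mx, addr0, add0r).
  by rewrite tr_scalar_mx -scalar_mxM -expr2 sqr_sqrtr // ltW.
exists ((block_mx 1%:M b 0 1%:M : 'M[R]_(1 + n)) *m
   block_mx (Num.sqrt s)%:M 0 0 N).
by rewrite trmx_mul !mulmxA.
Qed.

Lemma posdef_det (R : realType) n (A : 'M[R]_n) : posdefmx A -> 0 < \det A.
Proof.
move=> Ap; have := posdef_unit Ap; have [N ->] := posdef_cholesky Ap.
rewrite unitmxE unitfE det_mulmx det_tr -expr2 => h.
by rewrite lt_neqAle eq_sym h sqr_ge0.
Qed.

Lemma mxtrace_mul_tr_eq0 (R : realType) n (A : 'M[R]_n) :
  \tr (A *m A^T) = 0 -> A = 0.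
Proof.
have h0 i : 0 <= (A *m A^T) i i.
  by rewrite mxE sumr_ge0 // => j _; rewrite mxE -expr2 sqr_ge0.
move=> /eqP; rewrite psumr_eq0 // => /allP h.
apply/matrixP => i j; have := h i (mem_index_enum _).
rewrite mxE psumr_eq0 => [/allP /(_ j (mem_index_enum _))|k _].
  by rewrite !mxE -expr2 sqrf_eq0 => /eqP.
by rewrite mxE -expr2 sqr_ge0.
Qed.

(** With [P = N N^T] and [Q = L L^T] the trace is the squared Frobenius norm of [N^T E L], whose
    outer factors are invertible. *)
Lemma posdef_sandwich_eq0 (R : realType) n (P Q E : 'M[R]_n) :
  posdefmx P -> posdefmx Q -> symmx E -> \tr (P *m E *m Q *m E) = 0 -> E = 0.
Proof.
move=> Pp Qp Es; have := posdef_unit Pp; have := posdef_unit Qp.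
have [N ->] := posdef_cholesky Pp; have [L ->] := posdef_cholesky Qp.
rewrite !unitmx_mul !unitmx_tr !andbb => Lu Nu.
have -> : \tr (N *m N^T *m E *m (L *m L^T) *m E) =
    \tr ((N^T *m E *m L) *m (N^T *m E *m L)^T).
  by rewrite !trmx_mul trmxK Es -!mulmxA mxtrace_mulC !mulmxA.
move=> /mxtrace_mul_tr_eq0 h.
have {}h : N^T *m E = 0 by rewrite -[LHS](mulmxK Lu) h mul0mx.
by rewrite -[E](mulKmx (_ : N^T \in unitmx)) ?unitmx_tr // h mulmx0.
Qed.

(** * The trace-orthogonal decomposition of a positive definite matrix *)

(** For nonzero [t] the determinant is the characteristic polynomial of [B] with its coefficients
    reversed. Its two top coefficients give [1 - t * \tr B]; every other one carries at least
    [t ^+ 2]. *)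
Lemma det_first_order (R : realType) n (B : 'M[R]_n) : exists K,
  forall t : R, `|t| <= 1 -> `|\det (1%:M - t *: B) - 1 + t * \tr B| <= K * t ^+ 2.
Proof.
case: n B => [|m] B.
  by exists 0 => t _; rewrite det_mx00 /mxtrace big_ord0 subrr mulr0 addr0 mul0r normr0.
exists (\sum_(i < m) `|(char_poly B)`_i|) => t t1.
have [->|t0] := eqVneq t 0.
  by rewrite scale0r subr0 det1 subrr mul0r addr0 normr0 expr0n mulr0.
have -> : \det (1%:M - t *: B) = t ^+ m.+1 * (char_poly B).[t^-1].
  rewrite -[_.[_]]/(horner_eval t^-1 (\det _)) -det_map_mx -detZ.
  congr (\det _); apply/matrixP => i j; rewrite !mxE rmorphB rmorphMn /=.
  by rewrite /horner_eval hornerX hornerC mulrBr mulrnAr mulfV.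
rewrite horner_coef size_char_poly mulr_sumr 2!big_ord_recr /=.
have -> : (char_poly B)`_m = - \tr B by rewrite -char_poly_trace.
have -> : (char_poly B)`_m.+1 = 1.
  by have /monicP := char_poly_monic B; rewrite lead_coefE size_char_poly.
have -> : t ^+ m.+1 * (- \tr B * t^-1 ^+ m) = - (t * \tr B).
  by rewrite exprS exprVn mulrCA mulrA mulrA mulfK ?expf_neq0 //; ring.
rewrite mul1r exprVn mulfV ?expf_neq0 // addrK subrK.
rewrite mulr_suml (le_trans (ler_norm_sum _ _ _)) // ler_sum // => i _.
have -> : t ^+ m.+1 * ((char_poly B)`_i * t^-1 ^+ i) =
    (char_poly B)`_i * t ^+ (m.-1 - i) * t ^+ 2.
  have -> : t ^+ m.+1 = t ^+ (m.-1 - i + 2 + i).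
    by congr (_ ^+ _); have := ltn_ord i; lia.
  by rewrite !exprD exprVn; field; rewrite expf_neq0.
rewrite normrM [X in _ * X]ger0_norm ?sqr_ge0 // ler_wpM2r ?sqr_ge0 //.
by rewrite normrM ler_piMr // normrX exprn_ile1.
Qed.

(** If the trace [s] were nonzero, a small step [t = - (r * s)] would give a determinant of at least
    [1 + r * s ^+ 2 * (1 - r * K)], which exceeds 1. *)
Lemma det_local_max_trace (R : realType) n (B : 'M[R]_n) (e : R) : 0 < e ->
  (forall t : R, `|t| <= e -> \det (1%:M - t *: B) <= 1) -> \tr B = 0.
Proof.
move=> e0 dmax; have [K HK] := det_first_order B.
apply/eqP/negPn/negP => s0; set s := \tr B in HK s0.
have s20 : 0 < s ^+ 2 by rewrite lt_neqAle sqr_ge0 andbT eq_sym sqrf_eq0.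
have ns0 : 0 < `|s| by rewrite normr_gt0.
have K0 : 0 <= K.
  have := HK 1; rewrite normr1 expr1n mulr1 => /(_ (lexx _)).
  exact: le_trans.
have K1 : 0 < K + 1 by rewrite ltr_wpDl.
have s1 : 0 < 1 + `|s| by rewrite ltr_wpDr.
(* [x] exceeds both [|s|] and [K + 1], so [r = 1 / (1 + x / e + x)] is small enough for the three
   bounds [rs_e], [rs_1] and [rK] at once. *)
pose x := (K + 1) * (1 + `|s|); have x0 : 0 < x by rewrite mulr_gt0.
have sx : `|s| < x.
  have -> : x = K * `|s| + K + (1 + `|s|) by rewrite /x; ring.
  by have := mulr_ge0 K0 (ltW ns0); lra.
have Kx : K + 1 < x.
  have -> : x = K + 1 + (K + 1) * `|s| by rewrite /x; ring.
  by rewrite ltrDl mulr_gt0.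
pose D := 1 + x / e + x.
have xe0 : 0 < x / e by rewrite divr_gt0.
have D0 : 0 < D by rewrite !addr_gt0.
pose r := D^-1; have r0 : 0 < r by rewrite invr_gt0.
have rs_e : r * `|s| <= e.
  rewrite /r mulrC ler_pdivrMr //.
  have -> : e * D = e + x + e * x by rewrite /D; field; rewrite gt_eqF.
  by have := mulr_gt0 e0 x0; lra.
have rs_1 : r * `|s| <= 1.
  by rewrite /r mulrC ler_pdivrMr // mul1r /D; lra.
have rK : r * (K + 1) < 1.
  by rewrite /r mulrC ltr_pdivrMr // mul1r /D; lra.
have nt : `|- (r * s)| = r * `|s| by rewrite normrN normrM (gtr0_norm r0).
have := dmax (- (r * s)); rewrite nt => /(_ rs_e) d1.
have := HK (- (r * s)); rewrite nt => /(_ rs_1).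
rewrite ler_norml => /andP[h _].
have : r * s ^+ 2 * (1 - r * K) <= 0.
  have -> : r * s ^+ 2 * (1 - r * K) = r * s * s - K * (- (r * s)) ^+ 2 by ring.
  move: d1 h; rewrite mulNr.
  by move: (\det _) (r * s * s) (K * _) => y p q; lra.
rewrite leNgt => /negP; apply; apply: mulr_gt0; first exact: mulr_gt0 s20.
by move: rK r0; rewrite mulrDr mulr1; clearbody r; lra.
Qed.

Lemma continuous_sumr (R : realType) (T : topologicalType) (I : Type)
    (r : seq I) (P : pred I) (F : I -> T -> R) :
  (forall i, continuous (F i)) -> continuous (fun x => \sum_(i <- r | P i) F i x).
Proof.
move=> cF; elim: r => [|i r IH] x.
  by under eq_fun do rewrite big_nil; exact: cst_continuous.
under eq_fun do rewrite big_cons; case: (P i); last exact: IH.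
by apply: cvgD; [exact: cF|exact: IH].
Qed.

Lemma continuous_prodr (R : realType) (T : topologicalType) (I : Type)
    (r : seq I) (P : pred I) (F : I -> T -> R) :
  (forall i, continuous (F i)) -> continuous (fun x => \prod_(i <- r | P i) F i x).
Proof.
move=> cF; elim: r => [|i r IH] x.
  by under eq_fun do rewrite big_nil; exact: cst_continuous.
under eq_fun do rewrite big_cons; case: (P i); last exact: IH.
by apply: cvgM; [exact: cF|exact: IH].
Qed.

Lemma continuous_det (R : realType) (T : topologicalType) n (F : T -> 'M[R]_n) :
  (forall i j, continuous (fun x => F x i j)) -> continuous (fun x => \det (F x)).
Proof.
move=> cF; apply: continuous_sumr => s x; apply: cvgM.
  exact: cst_continuous.
exact: continuous_prodr.
Qed.

Lemma posdef_trace_decomposition (R : realType) n (V : {vspace 'M[R]_n})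
    (L : 'M[R]_n) :
  posdefmx L -> (forall D, D \in V -> symmx D /\ \tr D = 0) ->
  exists G, [/\ G \in V, posdefmx (L - G) &
    forall D, D \in V -> \tr (invmx (L - G) *m D) = 0].
Proof.
move=> Lp VD; pose m := \dim V; pose b := vbasis V.
(* The maximization takes place in the coordinates of [V], where closed bounded sets of row vectors
   are compact. *)
pose Gam (c : 'rV[R]_m) := \sum_i c 0 i *: b`_i.
have GamV c : Gam c \in V.
  by apply: memv_suml => i _; apply: memvZ; apply: vbasis_mem; rewrite mem_nth ?size_tuple.
have LGs c : symmx (L - Gam c).
  by rewrite /symmx linearB /= (VD _ (GamV c)).1 Lp.1.
have cG k l : continuous (fun c => (L - Gam c) k l).
  have -> : (fun c => (L - Gam c) k l) =
      (fun c => L k l + \sum_i c 0 i * - b`_i k l).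
    apply/funext => c; rewrite !mxE summxE -sumrN; congr (_ + _).
    by apply: eq_bigr => i _; rewrite mxE mulrN.
  have cS : continuous (fun c : 'rV[R]_m => \sum_i c 0 i * - b`_i k l).
    apply: continuous_sumr => i c.
    apply: (@continuousM _ _ (fun c : 'rV[R]_m => c 0 i) (cst (- b`_i k l))).
      exact: coord_continuous.
    exact: cst_continuous.
  by move=> c; apply: continuousD; [exact: cst_continuous|exact: cS].
pose K := [set c : 'rV[R]_m | forall v, 0 <= quadform (L - Gam c) v].
have clK : closed K.
  have -> : K = \bigcap_(v in setT) [set c | 0 <= quadform (L - Gam c) v].
    by apply/seteqP; split=> c h v *; exact: h.
  apply: closed_bigI => v _.
  suff /continuous_closedP/(_ _ (@closed_ge R 0)) :
    continuous (fun c => quadform (L - Gam c) v) by [].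
  under eq_fun do rewrite quadform_sumE.
  apply: continuous_sumr => k; apply: continuous_sumr => l c.
  apply: (@continuousM _ _ (fun c => (L - Gam c) k l) (cst (v 0 k * v 0 l))).
    exact: cG.
  exact: cst_continuous.
(* On [K] the matrix [L - Gam c] has the fixed trace [\tr L], which bounds its entries by
   [psd_entry_le]; the coordinates [c] are linear functions of the entries of [Gam c]. *)
have [M KM] : exists M, forall c, K c -> forall i, - M <= c 0 i <= M.
  pose B := \tr L + \sum_k \sum_l `|L k l|.
  exists (\sum_i \sum_k \sum_l B * `|coord b i (delta_mx k l)|) => c Kc i.
  rewrite -ler_norml.
  have -> : c 0 i = coord b i (Gam c).
    by rewrite /Gam coord_sum_free // (basis_free (vbasisP V)).
  have GB k l : `|Gam c k l| <= B.
    have := psd_entry_le k l (LGs c) Kc; rewrite linearB /= (VD _ (GamV c)).2 subr0.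
    rewrite !mxE /B => h.
    have : `|L k l| <= \sum_k \sum_l `|L k l|.
      rewrite (bigD1 k) //= (bigD1 l) //= -addrA lerDl addr_ge0 // ?sumr_ge0 //.
      by move=> k' _; rewrite sumr_ge0.
    have -> : Gam c k l = L k l - (L k l - Gam c k l) by ring.
    by move=> h'; rewrite (le_trans (ler_normB _ _)) // addrC lerD.
  have hS (j : 'I_m) : 0 <= \sum_k \sum_l B * `|coord b j (delta_mx k l)|.
    apply: sumr_ge0 => k _; apply: sumr_ge0 => l _; apply: mulr_ge0 => //.
    exact: le_trans (GB k l).
  rewrite (bigD1 i) //= (le_trans (y := \sum_k \sum_l B * `|coord b i (delta_mx k l)|)) //.
    rewrite [in X in X <= _](matrix_sum_delta (Gam c)) linear_sum /=.
    rewrite (le_trans (ler_norm_sum _ _ _)) // ler_sum // => k _.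
    rewrite linear_sum (le_trans (ler_norm_sum _ _ _)) // ler_sum // => l _.
    by rewrite linearZ /= normrM ler_wpM2r.
  by rewrite lerDl sumr_ge0.
have cK : compact K.
  have cM : compact [set c : 'rV[R]_m | forall i, `[- M, M]%classic (c ord0 i)].
    apply: (@rV_compact _ _ (fun=> `[- M, M]%classic)) => _.
    exact: segment_compact.
  apply: subclosed_compact clK cM _ => c Kc i /=.
  by rewrite in_itv /=; exact: KM.
have K0 : K 0.
  move=> v; rewrite (_ : Gam 0 = 0) ?subr0; first exact: posdef_ge0.
  by rewrite /Gam big1 // => i _; rewrite mxE scale0r.
have [c cinK cmax] : exists2 c, c \in K &
    forall t, t \in K -> \det (L - Gam t) <= \det (L - Gam c).
  apply: compact_EVT_max => //; first by exists 0.
  exact/continuous_subspaceT/continuous_det.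
have Kc : K c by rewrite inE in cinK.
(* The competitor 0 already has the positive determinant of [L]. *)
have dG0 : 0 < \det (L - Gam c).
  apply: lt_le_trans (cmax 0 _); last by rewrite inE.
  rewrite (_ : Gam 0 = 0) ?subr0; first exact: posdef_det.
  by rewrite /Gam big1 // => i _; rewrite mxE scale0r.
have Ap : posdefmx (L - Gam c).
  by apply: psd_unit_posdef => //; rewrite unitmxE unitfE gt_eqF.
exists (Gam c); split=> // D DV; set A := L - Gam c in Ap dG0 *.
have Au := posdef_unit Ap.
have [a a0 Aa] := posdef_coercive Ap.
pose k := \sum_i \sum_j `|D i j|.
have k0 : 0 <= k by apply: sumr_ge0 => i _; apply: sumr_ge0.
(* For [t] in this range [t *: D] is dominated by the coercivity constant [a] of [A], so
   [A - t *: D] stays semidefinite; the [+ 1] covers the case [k = 0]. *)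
apply: (@det_local_max_trace _ _ _ (a / (k + 1))).
  by rewrite divr_gt0 // ltr_wpDl.
(* Multiplication by [\det A] turns the claim into the comparison of [\det (A - t *: D)] with the
   maximum; [ct] holds the coordinates of this competitor. *)
move=> t te; rewrite -(ler_pM2l dG0) mulr1.
rewrite -det_mulmx mulmxBr mulmx1 -scalemxAr mulmxA mulmxV // mul1mx.
pose ct := c + t *: \row_i coord b i D.
have Gct : L - Gam ct = A - t *: D.
  rewrite /A /Gam -addrA -opprD; congr (L - _).
  rewrite [X in _ + t *: X](coord_vbasis DV) scaler_sumr -big_split /=.
  by apply: eq_bigr => i _; rewrite !mxE scalerDl scalerA.
rewrite -Gct; apply: cmax; rewrite inE => v; rewrite Gct quadformB quadformZ.
rewrite subr_ge0 (le_trans (ler_norm _)) // normrM.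
have := quadform_abs_le D v; rewrite -/k => hD.
apply: le_trans (Aa v); rewrite (le_trans (ler_wpM2l _ hD)) //.
rewrite mulrA ler_wpM2r ?quadform1_ge0 //.
move: te; rewrite ler_pdivlMr ?ltr_wpDl // => te.
have := normr_ge0 t; nra.
Qed.

(** The difference [E] of the two inverses lies in [V] and [Q1 E Q2 = Q1 - Q2], so orthogonality
    makes the trace of [Q1 E Q2 E] vanish; [posdef_sandwich_eq0] then gives [E = 0]. *)
Lemma posdef_trace_decomposition_uniq (R : realType) n (V : {vspace 'M[R]_n})
    (L Q1 G1 Q2 G2 : 'M[R]_n) :
  L = invmx Q1 + G1 -> L = invmx Q2 + G2 -> posdefmx Q1 -> posdefmx Q2 ->
  G1 \in V -> G2 \in V ->
  (forall D, D \in V -> \tr (Q1 *m D) = 0) ->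
  (forall D, D \in V -> \tr (Q2 *m D) = 0) -> Q1 = Q2 /\ G1 = G2.
Proof.
move=> L1 L2 Q1p Q2p G1V G2V D1 D2.
have Q1u := posdef_unit Q1p; have Q2u := posdef_unit Q2p.
pose E := invmx Q2 - invmx Q1.
have EE : E = G1 - G2.
  by apply/eqP; rewrite /E subr_eq addrAC -subr_eq opprK -L2 L1 addrC.
have E0 : E = 0.
  apply: (posdef_sandwich_eq0 Q1p Q2p).
    by rewrite /symmx /E linearB /= !symmx_inv //; [case: Q1p|case: Q2p].
  have -> : Q1 *m E *m Q2 = Q1 - Q2.
    rewrite /E mulmxBr mulmxV // mulmxBl mul1mx -mulmxA mulVmx // mulmx1.
    by [].
  by rewrite EE mulmxBl linearB /= D1 ?D2 ?memvB // subrr.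
move: E0 EE; rewrite /E => /eqP; rewrite subr_eq0 => /eqP h.
rewrite h subrr => /esym/eqP; rewrite subr_eq0 => /eqP ->; split=> //.
by rewrite -[Q1]invmxK -h invmxK.
Qed.

(** * Lebesgue measure on tuples *)

Section lebesgue_line.
Context {R : realType}.
Local Notation mu := (@lebesgue_measure R).
Local Open Scope ereal_scope.

Lemma lebesgue_measureD (c : R) (A : set R) : measurable A ->
  pushforward mu (fun x : measurableTypeR R => (x + c)%R : measurableTypeR R) A =
  mu A.
Proof.
have mc : measurable_fun setT (fun x : measurableTypeR R => (x + c)%R : measurableTypeR R).
  exact: measurable_funD.
pose m := measure_function_pushforward__canonical__measure_function_Measure mu mc.
move=> mA; apply/esym/(@lebesgue_measure_unique _ m) => //= _ [[a b]] _ <-.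
rewrite /m /= /pushforward.
have -> : (fun x : R => (x + c)%R) @^-1` `]a, b] = `](a - c)%R, (b - c)%R]%classic.
  by apply/seteqP; split=> x /=; rewrite !in_itv /= => /andP[? ?]; apply/andP; split; lra.
rewrite !lebesgue_measure_itv /= !lte_fin ltrD2r.
by case: ifP => // _; rewrite -!EFinD; congr _%:E; lra.
Qed.

Lemma ge0_integral_lebesgueD (c : R) (f : R -> \bar R) :
  measurable_fun setT f -> (forall x, 0 <= f x) ->
  \int[mu]_x f (x + c)%R = \int[mu]_x f x.
Proof.
move=> mf f0.
have mc : measurable_fun setT (fun x : measurableTypeR R => (x + c)%R : measurableTypeR R).
  exact: measurable_funD.
have := @ge0_integral_pushforward _ _ _ _ _ _ mc mu setT f measurableT mf (fun y _ => f0 y).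
rewrite preimage_setT => <-.
by apply: eq_measure_integral => A mA _; exact: lebesgue_measureD.
Qed.

Lemma ge0_integral_lebesgueN (f : R -> \bar R) :
  measurable_fun setT f -> (forall x, 0 <= f x) ->
  \int[mu]_x f (- x)%R = \int[mu]_x f x.
Proof.
move=> mf f0.
have mc : measurable_fun setT (fun x : measurableTypeR R => (- x)%R : measurableTypeR R).
  exact: measurable_funN.
have := @ge0_integral_pushforward _ _ _ _ _ _ mc mu setT f measurableT mf (fun y _ => f0 y).
rewrite preimage_setT => <-.
by apply: eq_measure_integral => A mA _; exact: lebesgue_measureN.
Qed.

End lebesgue_line.

(** * Adding one Lebesgue coordinate to a measure on tuples *)

Section cons_measure.
Context {R : realType}.
Local Open Scope ereal_scope.

Definition tuple_cons n (p : R * n.-tuple R) : n.+1.-tuple R :=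
  [tuple of p.1 :: p.2].

Lemma measurable_tuple_cons n : measurable_fun setT (@tuple_cons n).
Proof. exact: measurable_cons. Qed.

Variables (n : nat) (L : {sigma_finite_measure set (n.-tuple R) -> \bar R}).

Definition cons_measure :=
  pushforward (@lebesgue_measure R \x L) (@tuple_cons n).

HB.instance Definition _ := Measure.copy cons_measure
  (measure_function_pushforward__canonical__measure_function_Measure
     (@lebesgue_measure R \x L) (measurable_tuple_cons (n := n))).

(** Sigma-finiteness must be passed on for the product with the line to be iterated and Tonelli's
    theorem to apply at each dimension. *)
Let cons_measure_sigma_finite : sigma_finite setT cons_measure.
Proof.
have /sigma_finiteP[F [TF ndF Foo]] := sigma_finiteT (@lebesgue_measure R).
have /sigma_finiteP[G [TG ndG Goo]] := sigma_finiteT L.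
pose bh (t : n.+1.-tuple R) : n.-tuple R := [tuple of behead t].
have mbh : measurable_fun setT bh by exact: measurable_behead.
have bhE x t : bh (tuple_cons (x, t)) = t by exact: val_inj.
exists (fun k => [set t | F k (thead t)] `&` [set t | G k (bh t)]).
  apply/seteqP; split=> // t _.
  have : setT (thead t) by []; rewrite TF => -[i _ Fi].
  have : setT (bh t) by []; rewrite TG => -[j _ Gj].
  (* Both exhausting sequences increase, so the larger index serves for both. *)
  exists (maxn i j) => //; split=> /=.
    by move: Fi; exact/subsetPset/ndF/leq_maxl.
  by move: Gj; exact/subsetPset/ndG/leq_maxr.
move=> k; have [mF Fk] := Foo k; have [mG Gk] := Goo k; split.
  apply: measurableI.
    by rewrite -[X in measurable X]setTI; exact: (measurable_tnth ord0).
  by rewrite -[X in measurable X]setTI; exact: mbh.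
rewrite /cons_measure /pushforward.
have -> : @tuple_cons n @^-1`
    ([set t | F k (thead t)] `&` [set t | G k (bh t)]) = F k `*` G k.
  by apply/seteqP; split=> -[x t] /=; rewrite theadE bhE.
by rewrite product_measure1E // lte_mul_pinfty // ge0_fin_numE.
Qed.

HB.instance Definition _ := Measure_isSigmaFinite.Build _ _ _ cons_measure
  cons_measure_sigma_finite.

Lemma ge0_integral_cons_measure (f : n.+1.-tuple R -> \bar R) :
  measurable_fun setT f -> (forall z, 0 <= f z) ->
  \int[cons_measure]_z f z = \int[lebesgue_measure]_x \int[L]_t f [tuple of x :: t].
Proof.
move=> mf f0; rewrite ge0_integral_pushforward //; last exact: measurable_tuple_cons.
rewrite preimage_setT fubini_tonelli1 //; last by move=> x; exact: f0.
by apply: (measurableT_comp mf); exact: measurable_tuple_cons.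
Qed.

End cons_measure.

(** The iterated integral in [gauss_law] is realized by a genuine measure, which opens it to
    integration theory. The induction starts from the Dirac mass at the empty tuple. *)
Lemma lebesgue_iterint_measure (R : realType) n :
  exists L : {sigma_finite_measure set (n.-tuple R) -> \bar R},
    forall f, measurable_fun setT f -> (forall z, 0 <= f z)%E ->
    (\int[L]_z f z = lebesgue_iterint f)%E.
Proof.
elim: n => [|n [L IH]].
  exists (@dirac _ (0.-tuple R) [tuple] R) => f mf f0 /=.
  by rewrite integral_dirac // diracT mul1e.
exists (cons_measure L) => f mf f0; rewrite ge0_integral_cons_measure //=.
apply: eq_integral => x _; apply: IH => // .
exact: (measurableT_comp mf (measurable_cons (measurable_cst x) _)).
Qed.

(** The measure is obtained by choice; besides sigma-finiteness, it is known only through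
    [lebesgue_tupleE]. *)
Definition lebesgue_tuple (R : realType) n :
    {sigma_finite_measure set (n.-tuple R) -> \bar R} :=
  sval (cid (lebesgue_iterint_measure R n)).

(** * Tonelli's theorem, translations and linear reflections in n dimensions *)

Section lebesgue_tuple.
Context {R : realType}.
Local Open Scope ereal_scope.

Lemma lebesgue_tupleE n (f : n.-tuple R -> \bar R) :
  measurable_fun setT f -> (forall z, 0 <= f z) ->
  \int[lebesgue_tuple R n]_z f z = lebesgue_iterint f.
Proof. by rewrite /lebesgue_tuple; case: cid => L /=; apply. Qed.

Lemma measurable_cons_tuple n x :
  measurable_fun setT (fun t : n.-tuple R => [tuple of x :: t]).
Proof. exact: measurable_cons. Qed.

Lemma lebesgue_tupleS n (f : n.+1.-tuple R -> \bar R) :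
  measurable_fun setT f -> (forall z, 0 <= f z) ->
  \int[lebesgue_tuple R n.+1]_z f z =
  \int[lebesgue_measure]_x \int[lebesgue_tuple R n]_t f [tuple of x :: t].
Proof.
move=> mf f0; rewrite lebesgue_tupleE //=; apply: eq_integral => x _.
rewrite lebesgue_tupleE //.
exact: (measurableT_comp mf (measurable_cons_tuple x)).
Qed.

Lemma lebesgue_tupleS_swap n (f : n.+1.-tuple R -> \bar R) :
  measurable_fun setT f -> (forall z, 0 <= f z) ->
  \int[lebesgue_tuple R n.+1]_z f z =
  \int[lebesgue_tuple R n]_t \int[lebesgue_measure]_x f [tuple of x :: t].
Proof.
move=> mf f0; rewrite lebesgue_tupleS //.
apply: (fubini_tonelli (m1 := @lebesgue_measure R)
  (fun p : R * n.-tuple R => f [tuple of p.1 :: p.2])); last by move=> p; exact: f0.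
by apply: (measurableT_comp mf); exact: measurable_tuple_cons.
Qed.

Lemma tuple_of_rowK n : cancel (@tuple_of_row R n) (@row_of_tuple R n).
Proof. by move=> v; apply/rowP => i; rewrite mxE tnth_mktuple. Qed.

Lemma measurable_tuple_of_row d (T : measurableType d) n (g : T -> 'rV[R]_n) :
  (forall k, measurable_fun setT (fun x => g x 0%R k)) ->
  measurable_fun setT (fun x => tuple_of_row (g x)).
Proof.
move=> mg; apply/measurable_fun_tnthP => i.
by rewrite [X in measurable_fun _ X](_ : _ = (fun x => g x 0%R i)) //;
  apply/funext => x /=; rewrite tnth_mktuple.
Qed.

Lemma measurable_fun_sum_tnth n (c : 'I_n -> R) :
  measurable_fun setT (fun z : n.-tuple R => \sum_k c k * tnth z k)%R.
Proof.
by apply: measurable_sum => k; apply: measurable_funM => //; exact: measurable_tnth.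
Qed.

Lemma measurable_tuple_addZ d (T : measurableType d) n (g : T -> n.-tuple R)
    (h : T -> R) (v : 'rV[R]_n) :
  measurable_fun setT g -> measurable_fun setT h ->
  measurable_fun setT (fun x => tuple_of_row (row_of_tuple (g x) + h x *: v)%R).
Proof.
move=> mg mh; apply: measurable_tuple_of_row => k.
under eq_fun do rewrite !mxE.
apply: measurable_funD; last exact: measurable_funM.
exact: (measurableT_comp (measurable_tnth k) mg).
Qed.

Lemma tuple_addZ_cons n x (t : n.-tuple R) c (v : 'rV[R]_n.+1) :
  tuple_of_row (row_of_tuple [tuple of x :: t] + c *: v)%R =
  [tuple of (x + c * v 0 ord0)%R :: tuple_of_row (row_of_tuple t +
    c *: \row_i v 0 (lift ord0 i))%R].
Proof.
apply: eq_from_tnth => i; rewrite tnth_mktuple !mxE.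
have [j ->|->] := unliftP ord0 i; last by rewrite !tnth0.
by rewrite !tnthS tnth_mktuple !mxE.
Qed.

Lemma ge0_integral_lebesgue_tupleD n (v : 'rV[R]_n) (c : R) (f : n.-tuple R -> \bar R) :
  measurable_fun setT f -> (forall z, 0 <= f z) ->
  \int[lebesgue_tuple R n]_z f (tuple_of_row (row_of_tuple z + c *: v)%R) =
  \int[lebesgue_tuple R n]_z f z.
Proof.
elim: n v f => [|n IH] v f mf f0.
  by apply: eq_integral => z _; congr f; rewrite tuple0 [RHS]tuple0.
have mT : measurable_fun setT (fun z : n.+1.-tuple R =>
    tuple_of_row (row_of_tuple z + c *: v)%R).
  exact: (measurable_tuple_addZ (h := cst c)).
rewrite lebesgue_tupleS //; last exact: (measurableT_comp mf).
under eq_integral => x _.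
  under eq_integral => t _ do rewrite tuple_addZ_cons.
  rewrite (IH _ (fun t => f [tuple of (x + c * v 0 ord0)%R :: t])) //; last first.
    exact: (measurableT_comp mf (measurable_cons_tuple _)).
  over.
rewrite (ge0_integral_lebesgueD _
  (f := fun x => \int[lebesgue_tuple R n]_t f [tuple of x :: t])) //.
- by rewrite -lebesgue_tupleS.
- apply: (measurable_fun_fubini_tonelli_F
    (fun p : R * n.-tuple R => f [tuple of p.1 :: p.2])); last by move=> p; exact: f0.
  by apply: (measurableT_comp mf); exact: measurable_tuple_cons.
- by move=> x; apply: integral_ge0.
Qed.

(* Linear reflections preserve Lebesgue measure: for the first coordinate the
   map is a flip followed by translations of the other coordinates, otherwise
   the first coordinate is translated (Tonelli) and induction applies. *)
Lemma ge0_integral_lebesgue_tuple_refl n (p : 'I_n) (v : 'rV[R]_n)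
    (f : n.-tuple R -> \bar R) : (v 0 p = - 2)%R ->
  measurable_fun setT f -> (forall z, 0 <= f z) ->
  \int[lebesgue_tuple R n]_z f (tuple_of_row (row_of_tuple z + tnth z p *: v)%R) =
  \int[lebesgue_tuple R n]_z f z.
Proof.
elim: n p v f => [[]//|n IH] p v f vp mf f0.
have mT : measurable_fun setT (fun z : n.+1.-tuple R =>
    tuple_of_row (row_of_tuple z + tnth z p *: v)%R).
  by apply: measurable_tuple_addZ => //; exact: measurable_tnth.
have [j pE|pE] := unliftP ord0 p; rewrite pE in vp mT *.
  have mT' : measurable_fun setT (fun t : n.-tuple R => tuple_of_row
      (row_of_tuple t + tnth t j *: \row_i v 0 (lift ord0 i))%R).
    by apply: measurable_tuple_addZ => //; exact: measurable_tnth.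
  rewrite lebesgue_tupleS_swap //; last exact: (measurableT_comp mf).
  under eq_integral => t _.
    under eq_integral => x _ do rewrite tuple_addZ_cons tnthS.
    rewrite (ge0_integral_lebesgueD _ (f := fun x => f [tuple of x ::
       tuple_of_row (row_of_tuple t + tnth t j *: \row_i v 0 (lift ord0 i))%R])) //; last first.
      by apply: (measurableT_comp mf); exact: measurable_cons.
    over.
  rewrite (IH j _ (fun t => \int[lebesgue_measure]_x f [tuple of x :: t])) ?mxE //.
  - by rewrite -lebesgue_tupleS_swap.
  - apply: (measurable_fun_fubini_tonelli_G (m1 := @lebesgue_measure R)
      (fun p : R * n.-tuple R => f [tuple of p.1 :: p.2])); last by move=> q; exact: f0.
    by apply: (measurableT_comp mf); exact: measurable_tuple_cons.
  - by move=> t; apply: integral_ge0.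
rewrite lebesgue_tupleS //; last exact: (measurableT_comp mf).
under eq_integral => x _.
  under eq_integral => t _ do rewrite tuple_addZ_cons tnth0 vp.
  rewrite (ge0_integral_lebesgue_tupleD _ _
    (f := fun t => f [tuple of (x + x * (- 2))%R :: t])) //; last first.
    exact: (measurableT_comp mf (measurable_cons_tuple _)).
  rewrite (_ : (x + x * (-2))%R = (- x)%R); last by ring.
  over.
rewrite (ge0_integral_lebesgueN
  (f := fun x => \int[lebesgue_tuple R n]_t f [tuple of x :: t])) //.
- by rewrite -lebesgue_tupleS.
- apply: (measurable_fun_fubini_tonelli_F
    (fun p : R * n.-tuple R => f [tuple of p.1 :: p.2])); last by move=> q; exact: f0.
  by apply: (measurableT_comp mf); exact: measurable_tuple_cons.
- by move=> x; apply: integral_ge0.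
Qed.

End lebesgue_tuple.

(** * Gaussian measures *)

(** Completion of the square: the first variable separates, and the others are translated by a
    multiple of [b]. *)
Lemma quadform_schur (R : realType) n (s x : R) (b t : 'rV[R]_n) (C : 'M[R]_n) :
  quadform (block_mx 1%:M b 0 1%:M *m block_mx s%:M 0 0 C *m
    (block_mx 1%:M b 0 1%:M)^T) (row_mx x%:M t : 'rV[R]_(1 + n)) =
  s * x ^+ 2 + quadform C (t + x *: b).
Proof.
rewrite quadform_congr mul_row_block !(mulmx0, mulmx1, addr0) mul_scalar_mx.
rewrite /quadform mul_row_block !(mulmx0, addr0, add0r) tr_row_mx mul_row_col.
rewrite -scalar_mxM tr_scalar_mx -scalar_mxM mxE [X in X + _]mxE mulr1n.
by rewrite [x *: b + _]addrC; congr (_ + _); ring.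
Qed.

Lemma det_schur (R : realType) n (s : R) (b : 'rV[R]_n) (C : 'M[R]_n) :
  \det (block_mx 1%:M b 0 1%:M *m block_mx s%:M 0 0 C *m
    (block_mx 1%:M b 0 1%:M)^T : 'M[R]_(1 + n)) = s * \det C.
Proof.
rewrite !det_mulmx det_tr !det_ublock !det1 !mul1r mulr1.
by rewrite det_scalar1.
Qed.

Section gauss.
Context {R : realType}.

(** The unnormalized Gaussian density, indexed by the precision matrix (the inverse covariance), so
    that adding matrices multiplies kernels. *)
Definition gaussexp n (A : 'M[R]_n) (z : n.-tuple R) : R :=
  expR (- (2^-1 * quadform A (row_of_tuple z))).

Lemma measurable_quadform n (A : 'M[R]_n) :
  measurable_fun setT (fun z : n.-tuple R => quadform A (row_of_tuple z)).
Proof.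
under eq_fun do rewrite quadform_sumE.
apply: measurable_sum => k; apply: measurable_sum => l.
apply: measurable_funM => //; under eq_fun do rewrite !mxE.
by apply: measurable_funM; exact: measurable_tnth.
Qed.

Lemma measurable_gaussexp n (A : 'M[R]_n) : measurable_fun setT (gaussexp A).
Proof.
apply: measurableT_comp => //; apply: measurable_funN; apply: measurable_funM => //.
exact: measurable_quadform.
Qed.

Lemma gaussexp_gt0 n (A : 'M[R]_n) z : 0 < gaussexp A z.
Proof. exact: expR_gt0. Qed.

Lemma gaussexp_ge0 n (A : 'M[R]_n) z : 0 <= gaussexp A z.
Proof. exact: expR_ge0. Qed.

Lemma gaussexpD n (A B : 'M[R]_n) z :
  gaussexp (A + B) z = gaussexp A z * gaussexp B z.
Proof. by rewrite /gaussexp -expRD quadformD; congr expR; ring. Qed.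

Lemma integral_gauss_line (s : R) : 0 < s ->
  (\int[lebesgue_measure]_x (expR (- (2^-1 * (s * x ^+ 2))))%:E =
  (Num.sqrt (2 * pi / s))%:E)%E.
Proof.
move=> s0; pose sg := (Num.sqrt s)^-1.
have sg2 : sg ^+ 2 = s^-1 by rewrite exprVn sqr_sqrtr // ltW.
have sg0 : sg != 0 by rewrite invr_eq0 sqrtr_eq0 -ltNge.
have := integral_normal_pdf 0 sg.
rewrite (normal_pdfE 0 sg0).
under eq_integral => x _.
  have -> : normal_peak sg * normal_fun 0 sg x =
      (Num.sqrt (2 * pi / s))^-1 * expR (- (2^-1 * (s * x ^+ 2))).
    rewrite /normal_peak /normal_fun sg2 subr0; congr (_^-1 * expR _).
      by congr Num.sqrt; rewrite -mulr_natl; ring.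
    by rewrite -mulr_natl; field; rewrite gt_eqF.
  rewrite EFinM; over.
have P0 : 0 < Num.sqrt (2 * pi / s).
  by rewrite sqrtr_gt0 divr_gt0 // mulr_gt0 // pi_gt0.
have mE : measurable_fun setT (fun x : R => expR (- (2^-1 * (s * x ^+ 2)))).
  apply: measurableT_comp => //; apply: measurable_funN.
  by apply: measurable_funM => //; apply: measurable_funM.
rewrite ge0_integralZl //; last exact/measurable_EFinP.
move=> /(congr1 (fun y => (Num.sqrt (2 * pi / s))%:E * y)%E).
by rewrite mule1 muleA -EFinM mulfV ?gt_eqF // mul1e.
Qed.

(** Induction on [n]: after completing the square, translation invariance removes the first variable
    from the inner integral, and a one-dimensional Gaussian integral remains. *)
Lemma integral_gaussexp n (A : 'M[R]_n) : posdefmx A ->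
  (\int[lebesgue_tuple R n]_z (gaussexp A z)%:E =
   (Num.sqrt ((2 * pi) ^+ n / \det A))%:E)%E.
Proof.
elim: n A => [|n IH] A Ap.
  rewrite lebesgue_tupleE /=; last 2 first.
  - by apply/measurable_EFinP; exact: measurable_gaussexp.
  - by move=> z; rewrite lee_fin gaussexp_ge0.
  rewrite /gaussexp /quadform mxE big_ord0 mulr0 oppr0 expR0.
  by rewrite det_mx00 expr0 divr1 sqrtr1.
have mg k (B : 'M[R]_k) : measurable_fun setT (EFin \o gaussexp B).
  by apply/measurable_EFinP; exact: measurable_gaussexp.
have g0 k (B : 'M[R]_k) z : (0 <= (gaussexp B z)%:E)%E by rewrite lee_fin gaussexp_ge0.
rewrite lebesgue_tupleS //; last exact: mg.
have [s [b [C [s0 Cp AE]]]] := posdef_schur (Ap : posdefmx (A : 'M[R]_(1 + n))).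
have gE x (t : n.-tuple R) : gaussexp A [tuple of x :: t] =
    expR (- (2^-1 * (s * x ^+ 2))) *
    gaussexp C (tuple_of_row (row_of_tuple t + x *: b)).
  rewrite /gaussexp tuple_of_rowK -expRD; congr expR.
  have -> : row_of_tuple [tuple of x :: t] = row_mx x%:M (row_of_tuple t) :> 'rV[R]_(1 + n).
    apply/rowP => i; rewrite !mxE; case: splitP => j ij.
      rewrite mxE [j]ord1 /= mulr1n (_ : i = ord0) ?tnth0 //; apply: val_inj.
      by move: ij; rewrite [j]ord1.
    by rewrite mxE (_ : i = lift ord0 j) ?tnthS //; apply: val_inj.
  have -> : quadform A (row_mx x%:M (row_of_tuple t) : 'rV[R]_(1 + n)) =
      s * x ^+ 2 + quadform C (row_of_tuple t + x *: b).
    by rewrite AE; exact: quadform_schur.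
  by ring.
under eq_integral => x _.
  under eq_integral => t _ do rewrite gE EFinM.
  have mT : measurable_fun setT (fun t : n.-tuple R =>
      tuple_of_row (row_of_tuple t + x *: b)).
    exact: (measurable_tuple_addZ (h := cst x)).
  rewrite ge0_integralZl //; last first.
    apply: (@measurableT_comp _ _ _ _ _ _ (EFin \o gaussexp C)) => //; exact: mg.
  rewrite (ge0_integral_lebesgue_tupleD b x (f := EFin \o gaussexp C)) //; last first.
    by move=> z; exact: g0.
  rewrite IH //; over.
rewrite ge0_integralZr //; last first.
  apply/measurable_EFinP; apply: measurableT_comp => //; apply: measurable_funN.
  by apply: measurable_funM => //; apply: measurable_funM.
rewrite integral_gauss_line // -EFinM -sqrtrM; last first.
  by rewrite divr_ge0 // ?ltW // mulr_gt0 ?pi_gt0.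
have -> : \det A = s * \det C.
  by rewrite AE; exact: det_schur.
congr (Num.sqrt _)%:E; rewrite exprS; field.
by rewrite !gt_eqF // posdef_det.
Qed.

Lemma gauss_pdfE n (S : 'M[R]_n) z : gauss_pdf S z =
  (Num.sqrt ((2 * pi) ^+ n * \det S))^-1 * gaussexp (invmx S) z.
Proof. by []. Qed.

Lemma gauss_norm_gt0 n (S : 'M[R]_n) : posdefmx S ->
  0 < Num.sqrt ((2 * pi) ^+ n * \det S).
Proof.
by move=> Sp; rewrite sqrtr_gt0 mulr_gt0 ?posdef_det // exprn_gt0 // mulr_gt0 // pi_gt0.
Qed.

Lemma gauss_pdf_gt0 n (S : 'M[R]_n) z : posdefmx S -> 0 < gauss_pdf S z.
Proof.
by move=> Sp; rewrite gauss_pdfE mulr_gt0 ?gaussexp_gt0 // invr_gt0 gauss_norm_gt0.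
Qed.

Lemma measurable_gauss_pdf n (S : 'M[R]_n) : measurable_fun setT (gauss_pdf S).
Proof. by apply: measurable_funM => //; exact: measurable_gaussexp. Qed.

Lemma integral_gauss_pdf n (S : 'M[R]_n) : posdefmx S ->
  (\int[lebesgue_tuple R n]_z (gauss_pdf S z)%:E = 1)%E.
Proof.
move=> Sp; have S0 := gauss_norm_gt0 Sp.
under eq_integral do rewrite gauss_pdfE EFinM.
rewrite ge0_integralZl //=; last 2 first.
- by apply/measurable_EFinP; exact: measurable_gaussexp.
- by move=> z _; rewrite lee_fin gaussexp_ge0.
rewrite integral_gaussexp; last exact: posdef_inv.
by rewrite det_inv invrK -EFinM mulVf // gt_eqF.
Qed.

End gauss.

(** * Integration against a measure with a density *)

Section density.
Context d (T : measurableType d) (R : realType).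
Variables (L : {sigma_finite_measure set T -> \bar R}).
Variables (mu : {finite_measure set T -> \bar R}) (p : T -> R).
Local Open Scope ereal_scope.
Hypotheses (mp : measurable_fun setT p) (p0 : forall x, (0 <= p x)%R).
Hypothesis muE : forall A, measurable A -> mu A = \int[L]_(x in A) (p x)%:E.

(** [p] and the Radon-Nikodym derivative of [mu] have the same integral over every measurable set,
    hence agree almost everywhere; the change of variables is known for the derivative. *)
Lemma ge0_integral_density (f : T -> \bar R) :
  measurable_fun setT f -> (forall x, 0 <= f x) ->
  \int[mu]_x f x = \int[L]_x (f x * (p x)%:E).
Proof.
move=> mf f0.
have mp' : measurable_fun setT (EFin \o p) by exact/measurable_EFinP.
have muL : mu `<< L.
  apply/null_content_dominatesP => A mA LA; rewrite muE //.
  by apply: null_set_integral => //; exact: measurable_funTS.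
have ip : L.-integrable setT (EFin \o p).
  apply/integrableP; split=> //.
  under eq_integral => x _ do rewrite gee0_abs ?lee_fin //=.
  by rewrite -muE // ltey_eq fin_num_measure.
rewrite -(Radon_Nikodym_SigmaFinite.change_of_variables muL) //.
have mr := measurable_int _ (Radon_Nikodym_SigmaFinite.f_integrable muL).
apply: ae_eq_integral => //.
- exact: emeasurable_funM.
- exact: emeasurable_funM.
- apply: ae_eqe_mul2l; apply: integral_ae_eq => //.
    exact: Radon_Nikodym_SigmaFinite.f_integrable.
  move=> A _ mA; rewrite -muE //.
  by rewrite -Radon_Nikodym_SigmaFinite.f_integral.
Qed.

End density.

(** * The normal laws as probability measures *)

Section gauss_probability.
Context {R : realType} {n : nat} {S : 'M[R]_n}.
Local Open Scope ereal_scope.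

Definition gauss_prob (Sp : posdefmx S) (A : set (n.-tuple R)) : \bar R :=
  \int[lebesgue_tuple R n]_(z in A) (gauss_pdf S z)%:E.

Variable Sp : posdefmx S.

Let mpdf : measurable_fun setT (EFin \o gauss_pdf S).
Proof. by apply/measurable_EFinP; exact: measurable_gauss_pdf. Qed.

Let pdf0 z : 0 <= (EFin \o gauss_pdf S) z.
Proof. by rewrite lee_fin ltW // gauss_pdf_gt0. Qed.

Let gauss_prob0 : gauss_prob Sp set0 = 0.
Proof. exact: integral_set0. Qed.

Let gauss_prob_ge0 A : 0 <= gauss_prob Sp A.
Proof. by apply: integral_ge0 => z _; exact: pdf0. Qed.

Let gauss_prob_sigma_additive : semi_sigma_additive (gauss_prob Sp).
Proof.
move=> F mF tF mUF; rewrite /gauss_prob ge0_integral_bigcup //.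
- by apply: is_cvg_ereal_nneg_natsum_cond => k _ _; exact: gauss_prob_ge0.
- exact: measurable_funTS.
- by move=> z _; exact: pdf0.
Qed.

HB.instance Definition _ := isMeasure.Build _ _ _
  (gauss_prob Sp) gauss_prob0 gauss_prob_ge0 gauss_prob_sigma_additive.

Let gauss_probT : gauss_prob Sp setT = 1.
Proof. exact: integral_gauss_pdf. Qed.

HB.instance Definition _ :=
  @Measure_isProbability.Build _ _ R (gauss_prob Sp) gauss_probT.

Lemma gauss_lawP (mu : set (n.-tuple R) -> \bar R) :
  gauss_law S mu <-> forall A, measurable A -> mu A = gauss_prob Sp A.
Proof.
suff h A : measurable A ->
    gauss_prob Sp A = lebesgue_iterint (fun z => (\1_A z * gauss_pdf S z)%:E).
  by split=> hmu A mA; rewrite hmu // h.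
move=> mA; rewrite -lebesgue_tupleE; last 2 first.
- apply/measurable_EFinP; apply: measurable_funM; first exact: measurable_indic.
  exact: measurable_gauss_pdf.
- by move=> z; rewrite lee_fin mulr_ge0 // -lee_fin; exact: pdf0.
rewrite /gauss_prob integral_mkcond epatch_indic.
by apply: eq_integral => z _ /=; rewrite muleC -EFinM.
Qed.

Lemma ge0_integral_gauss_law (mu : {finite_measure set (n.-tuple R) -> \bar R})
    (f : n.-tuple R -> \bar R) : gauss_law S mu ->
  measurable_fun setT f -> (forall x, 0 <= f x) ->
  \int[mu]_x f x = \int[lebesgue_tuple R n]_x (f x * (gauss_pdf S x)%:E).
Proof.
move=> /gauss_lawP muE mf f0; apply: ge0_integral_density => //; exact: measurable_gauss_pdf.
Qed.

End gauss_probability.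

(** * Reflections and integrability under Gaussian measures *)

Section reflection.
Context {R : realType} {n : nat}.
Implicit Types (A Q : 'M[R]_n) (v : 'rV[R]_n) (p : 'I_n) (z : n.-tuple R).

(** A linear reflection when [v 0 p = - 2]: the coordinate [p] changes sign and the hyperplane where
    it vanishes is fixed. It is used with [flip_row p] and with a multiple of row [p] of a
    covariance matrix. *)
Definition refl_tuple p v z : n.-tuple R :=
  tuple_of_row (row_of_tuple z + tnth z p *: v).

Lemma measurable_refl_tuple p v : measurable_fun setT (refl_tuple p v).
Proof. by apply: measurable_tuple_addZ => //; exact: measurable_tnth. Qed.

Definition flip_row p : 'rV[R]_n := - 2 *: delta_mx 0 p.

Lemma flip_rowE p : flip_row p 0 p = - 2.
Proof. by rewrite !mxE !eqxx mulr1. Qed.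

Lemma tnth_flip p z l :
  tnth (refl_tuple p (flip_row p) z) l = if l == p then - tnth z p else tnth z l.
Proof.
rewrite tnth_mktuple !mxE eqxx /=; case: eqVneq => [->|_] /=.
  by rewrite mulr1; ring.
by rewrite !mulr0 addr0.
Qed.

(** For the form of [invmx Q], the product with [row p Q] is the coordinate [p]. The map is
    therefore the orthogonal reflection that reverses [row p Q], and it preserves the form. *)
Lemma gaussexp_refl Q p z : posdefmx Q ->
  gaussexp (invmx Q) (refl_tuple p (- (2 / Q p p) *: row p Q) z) =
  gaussexp (invmx Q) z.
Proof.
move=> Qp; have Qu := posdef_unit Qp; have Qs := Qp.1.
have Qpp : Q p p != 0.
  rewrite -bilform_delta gt_eqF //; apply: Qp.2.
  by apply/eqP => /matrixP/(_ 0 p)/eqP; rewrite !mxE !eqxx oner_eq0.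
have b u : bilform (invmx Q) u (row p Q) = u 0 p.
  by rewrite /bilform tr_row Qs colE mulmxA mulmxKV // -colE mxE.
rewrite /gaussexp /refl_tuple tuple_of_rowK quadformDZ; last exact: symmx_inv.
rewrite !quadformE !(bilformZl, bilformZr) !b !mxE.
by congr expR; field.
Qed.

Lemma gaussexp_flip (c : R) p z :
  gaussexp c%:M (refl_tuple p (flip_row p) z) = gaussexp c%:M z.
Proof.
have b u : bilform c%:M u (delta_mx 0 p) = c * u 0 p.
  by rewrite /bilform mul_mx_scalar trmx_delta -colE !mxE.
rewrite /gaussexp /refl_tuple tuple_of_rowK quadformDZ; last exact: tr_scalar_mx.
rewrite !quadformE !(bilformZl, bilformZr) !b !mxE !eqxx /= mulr1.
by congr expR; ring.
Qed.

Lemma integrable_refl p v (F : n.-tuple R -> \bar R) : v 0 p = - 2 ->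
  (lebesgue_tuple R n).-integrable setT F ->
  (lebesgue_tuple R n).-integrable setT (F \o refl_tuple p v).
Proof.
move=> vp /integrableP[mF iF]; apply/integrableP; split.
  by apply: measurableT_comp => //; exact: measurable_refl_tuple.
rewrite (ge0_integral_lebesgue_tuple_refl (f := fun z => `|F z|%E)) //.
exact: measurableT_comp.
Qed.

(** The reflection exchanges the positive and negative parts of [F], so their integrals coincide;
    integrability makes them finite. *)
Lemma integral_refl_odd p v (F : n.-tuple R -> \bar R) : v 0 p = - 2 ->
  (lebesgue_tuple R n).-integrable setT F ->
  (forall z, F (refl_tuple p v z) = - F z)%E ->
  (\int[lebesgue_tuple R n]_z F z = 0)%E.
Proof.
move=> vp iF FN; have mF := measurable_int _ iF.
have Fpn : (\int[lebesgue_tuple R n]_z F^\- z = \int[lebesgue_tuple R n]_z F^\+ z)%E.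
  rewrite -(ge0_integral_lebesgue_tuple_refl (f := F^\+%E) vp) //; last first.
    exact: measurable_funepos.
  apply: eq_integral => z _; rewrite -/(refl_tuple p v z).
  have FT : F \o refl_tuple p v = (\- F)%E by apply/funext => y; exact: FN.
  by rewrite -[RHS]/((F^\+ \o refl_tuple p v) z)%E -funepos_comp FT funeposN.
rewrite integralE Fpn subee //.
rewrite ge0_fin_numE; last by apply: integral_ge0 => z _; exact: funepos_ge0.
exact: integral_funepos_lt_pinfty.
Qed.

End reflection.

(** * Integrability against Gaussian kernels and comparison of kernels *)

Section gauss_integrability.
Context {R : realType} {n : nat}.
Implicit Types (A B S : 'M[R]_n) (f h : n.-tuple R -> R).
Local Notation L := (lebesgue_tuple R n).

Definition gauss_integrable A f : Prop :=
  measurable_fun setT f /\ L.-integrable setT (fun z => (f z * gaussexp A z)%:E).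

Lemma gauss_integrableP A f : measurable_fun setT f ->
  (L.-integrable setT (fun z => (f z * gaussexp A z)%:E) <->
   \int[L]_z (`|f z| * gaussexp A z)%:E < +oo)%E.
Proof.
move=> mf.
have E : (\int[L]_z `|(f z * gaussexp A z)%:E| =
    \int[L]_z (`|f z| * gaussexp A z)%:E)%E.
  apply: eq_integral => z _ /=.
  by rewrite normrM [X in _ * X]ger0_norm ?gaussexp_ge0.
split=> [/integrableP[_]|h]; first by rewrite E.
apply/integrableP; split; last by rewrite E.
apply/measurable_EFinP; apply: measurable_funM => //; exact: measurable_gaussexp.
Qed.

Lemma gauss_integrableB A f h : gauss_integrable A f -> gauss_integrable A h ->
  gauss_integrable A (f \- h).
Proof.
move=> [mf fi] [mh hi]; split; first exact: measurable_funB.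
apply: eq_integrable (integrableB measurableT fi hi) => // z _ /=.
by rewrite -EFinB -mulrBl.
Qed.

Lemma gauss_integrableZ A a f : gauss_integrable A f ->
  gauss_integrable A (fun z => a * f z).
Proof.
move=> [mf fi]; split; first exact: measurable_funM.
apply: eq_integrable (integrableZl measurableT a fi) => // z _ /=.
by rewrite -EFinM mulrA.
Qed.

Lemma gauss_integrable_le A B f c :
  (forall z, gaussexp A z <= c * gaussexp B z) ->
  gauss_integrable B f -> gauss_integrable A f.
Proof.
move=> AB [mf fi]; split=> //; have [_ ci] := gauss_integrableZ c (conj mf fi).
apply: le_integrable ci => //.
  by apply/measurable_EFinP; apply: measurable_funM => //; exact: measurable_gaussexp.
move=> z _ /=; rewrite lee_fin !normrM [`|gaussexp A z|]ger0_norm ?gaussexp_ge0 //.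
rewrite [`|gaussexp B z|]ger0_norm ?gaussexp_ge0 // mulrAC mulrC.
rewrite ler_wpM2r // (le_trans (AB z)) // ler_wpM2r ?gaussexp_ge0 //.
exact: ler_norm.
Qed.

Lemma gauss_integrable_flip (c : R) f p : gauss_integrable c%:M f ->
  gauss_integrable c%:M (f \o refl_tuple p (flip_row p)).
Proof.
move=> [mf fi]; split.
  by apply: measurableT_comp => //; exact: measurable_refl_tuple.
apply: eq_integrable (integrable_refl (flip_rowE p) fi) => // z _ /=.
by rewrite gaussexp_flip.
Qed.

Lemma gauss_integrable1 A : posdefmx A -> gauss_integrable A (cst 1).
Proof.
move=> Ap; split=> //; apply/gauss_integrableP => //.
under eq_integral do rewrite normr1 mul1r.
by rewrite integral_gaussexp // ltry.
Qed.

(** The dominating kernel is isotropic, hence invariant under coordinate flips, which a general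
    kernel is not. *)
Lemma gaussexp_coercive A : posdefmx A ->
  exists2 c, 0 < c & forall z, gaussexp A z <= gaussexp c%:M z.
Proof.
move=> Ap; have [c c0 Ac] := posdef_coercive Ap; exists c => // z.
rewrite ler_expR lerN2 ler_pM2l ?invr_gt0 //.
by rewrite -[c%:M]scalemx1 quadformZ.
Qed.

Lemma gauss_integrable_quadform A B : posdefmx A ->
  gauss_integrable A (fun z => quadform B (row_of_tuple z)).
Proof.
move=> Ap; have [c c0 Ac] := gaussexp_coercive Ap.
split; first exact: measurable_quadform.
pose K := \sum_k \sum_l `|B k l|.
have K0 : 0 <= K by apply: sumr_ge0 => k _; apply: sumr_ge0.
have c2p : posdefmx ((c / 2)%:M : 'M[R]_n).
  by rewrite -scalemx1; apply: posdefZ; [rewrite divr_gt0|exact: posdef1].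
have [_ ci] := gauss_integrableZ (4 / c * K) (gauss_integrable1 c2p).
apply: le_integrable ci => //.
  apply/measurable_EFinP; apply: measurable_funM.
    exact: measurable_quadform.
  exact: measurable_gaussexp.
move=> z _ /=; rewrite lee_fin mulr1 !normrM ![`|gaussexp _ z|]ger0_norm ?gaussexp_ge0 //.
rewrite [`|4|]ger0_norm // [`|c^-1|]gtr0_norm ?invr_gt0 // [`|K|]ger0_norm //.
set q := quadform 1%:M (row_of_tuple z).
have q0 : 0 <= q by exact: quadform1_ge0.
have qB : `|quadform B (row_of_tuple z)| <= K * q by exact: quadform_abs_le.
have gE (a : R) : gaussexp a%:M z = expR (- (2^-1 * (a * q))).
  by rewrite /gaussexp -scalemx1 quadformZ.
(* Half of the exponent absorbs the factor [q], through [x <= expR x] at [x = c / 4 * q]. *)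
have qe : q * gaussexp c%:M z <= 4 / c * gaussexp (c / 2)%:M z.
  have h : c / 4 * q <= expR (c / 4 * q).
    by apply: le_trans (expR_ge1Dx _); rewrite lerDr.
  rewrite !gE.
  have -> : - (2^-1 * (c * q)) = - (2^-1 * (c / 2 * q)) - c / 4 * q by field.
  rewrite expRD [expR (- (c / 4 * q))]expRN mulrCA [leRHS]mulrC ler_wpM2l ?expR_ge0 //.
  rewrite ler_pdivrMr ?expR_gt0 //.
  rewrite -(ler_pM2l (_ : 0 < c / 4)) ?divr_gt0 // (le_trans h) //.
  by rewrite !mulrA divfK ?gt_eqF // divff // ?mul1r // gt_eqF.
apply: (@le_trans _ _ (K * q * gaussexp c%:M z)).
  by apply: ler_pM => //; exact: gaussexp_ge0.
have -> : 4 / c * K * gaussexp (c / 2)%:M z = K * (4 / c * gaussexp (c / 2)%:M z).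
  by ring.
by rewrite -mulrA ler_wpM2l.
Qed.

Lemma gauss_law_integrableP S (mu : probability (n.-tuple R) R) f :
  posdefmx S -> gauss_law S mu -> measurable_fun setT f ->
  (mu.-integrable setT (EFin \o f) <-> gauss_integrable (invmx S) f).
Proof.
move=> Sp Smu mf; have K0 := gauss_norm_gt0 Sp.
set K := Num.sqrt _ in K0.
have mfg : measurable_fun setT (fun z => (`|f z| * gaussexp (invmx S) z)%:E).
  apply/measurable_EFinP; apply: measurable_funM; last exact: measurable_gaussexp.
  exact: measurableT_comp.
have E : (\int[mu]_z `|(EFin \o f) z| =
    K^-1%:E * \int[L]_z (`|f z| * gaussexp (invmx S) z)%:E)%E.
  rewrite (ge0_integral_gauss_law Sp Smu) //; last first.
    by apply: measurableT_comp => //; exact/measurable_EFinP.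
  rewrite -ge0_integralZl //; last 2 first.
  - by move=> z _; rewrite lee_fin mulr_ge0 ?gaussexp_ge0.
  - by rewrite lee_fin invr_ge0 ltW.
  by apply: eq_integral => z _; rewrite /= gauss_pdfE -!EFinM mulrCA.
split=> [/integrableP[_]|[_ /(gauss_integrableP _ mf) h]].
  rewrite E => h; split=> //; apply/gauss_integrableP => //.
  rewrite ltNge leye_eq; apply/negP => /eqP hy; move: h.
  by rewrite hy gt0_muley ?lte_fin ?invr_gt0.
apply/integrableP; split; first exact/measurable_EFinP.
by rewrite E lte_mul_pinfty // lee_fin invr_ge0 ltW.
Qed.

End gauss_integrability.

(** * Extracting the terms of a wealth *)

Section lebesgue_nullctions.
Context {R : realType} {n : nat}.
Local Notation L := (lebesgue_tuple R n).
Implicit Types (f h : n.-tuple R -> R).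

(** Nullity is expressed by an integral so that invariance of integrals under reflections and
    translations applies to it directly. *)
Definition lebesgue_null f : Prop :=
  measurable_fun setT f /\ (\int[L]_z `|(f z)%:E| = 0)%E.

Lemma lebesgue_null_ae f : measurable_fun setT f ->
  (lebesgue_null f <-> {ae L, forall z, f z = 0}).
Proof.
move=> mf.
have := @ae_eq_integral_abs _ _ _ L setT measurableT (EFin \o f).
move=> /(_ ((measurable_EFinP _ _).2 mf)) h; split=> [[_ /h]|h0].
  by apply: filterS => z /(_ I) [].
by split=> //; apply/h; apply: filterS h0 => z /= ->.
Qed.

Lemma lebesgue_nullB f h : lebesgue_null f -> lebesgue_null h -> lebesgue_null (f \- h).
Proof.
move=> nf nh; have [mf mh] := (nf.1, nh.1).
apply/lebesgue_null_ae; first exact: measurable_funB.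
apply: filterS2 ((lebesgue_null_ae mf).1 nf) ((lebesgue_null_ae mh).1 nh) => z /= -> ->.
by rewrite subrr.
Qed.

Lemma lebesgue_nullZ a f : lebesgue_null f -> lebesgue_null (fun z => a * f z).
Proof.
move=> nf; have mf := nf.1.
apply/lebesgue_null_ae; first exact: measurable_funM.
by apply: filterS ((lebesgue_null_ae mf).1 nf) => z /= ->; rewrite mulr0.
Qed.

Lemma lebesgue_null_refl f p (v : 'rV[R]_n) : v 0 p = - 2 -> lebesgue_null f ->
  lebesgue_null (f \o refl_tuple p v).
Proof.
move=> vp [mf f0]; split.
  by apply: measurableT_comp => //; exact: measurable_refl_tuple.
rewrite (ge0_integral_lebesgue_tuple_refl (f := fun z => `|(f z)%:E|%E)) //.
by apply: measurableT_comp => //; exact/measurable_EFinP.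
Qed.

Lemma lebesgue_null_translate f (v : 'rV[R]_n) : lebesgue_null f ->
  lebesgue_null (fun z => f (tuple_of_row (row_of_tuple z + v))).
Proof.
move=> [mf f0]; rewrite -[v]scale1r; split.
  apply: (measurableT_comp mf).
  exact: (measurable_tuple_addZ (h := cst 1)).
rewrite (ge0_integral_lebesgue_tupleD _ _ (f := fun z => `|(f z)%:E|%E)) //.
by apply: measurableT_comp => //; exact/measurable_EFinP.
Qed.

Lemma gauss_prob_null (S : 'M[R]_n) (Sp : posdefmx S) f : lebesgue_null f ->
  gauss_prob Sp [set z | f z != 0] = 0%E.
Proof.
move=> nf; have [mf _] := nf.
have mN : measurable [set z | f z != 0].
  rewrite (_ : mkset _ = f @^-1` [set~ 0]); last first.
    by apply/seteqP; split=> z /= /eqP.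
  by rewrite -[X in measurable X]setTI; apply: mf => //; exact: measurableC.
apply: null_set_integral => //; last first.
  apply/negligibleP => //; have := (lebesgue_null_ae mf).1 nf.
  by rewrite /prop_near1/= /almost_everywhere; apply: negligibleS => z /= /eqP.
by apply/measurable_EFinP/measurable_funTS; exact: measurable_gauss_pdf.
Qed.

End lebesgue_nullctions.

(** * Order of the coordinates in time, and isolation of single terms by flips *)

Section market_positions.
Context {R : realType} (M : market R).
Implicit Types (i : 'I_(horizon M)) (z : (nvars M).-tuple R).

Lemma npast_lt i i' : (i' < i)%N -> (npast M i' + nvar M i' <= npast M i)%N.
Proof.
move=> ii; rewrite [leqRHS](bigD1 i') //= addnC leq_add2l.
rewrite big_mkcond [leqRHS]big_mkcond leq_sum // => k _.
case: ifP => // ki; case: ifP => // /negP; case.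
by rewrite (ltn_trans ki ii) neq_ltn ki.
Qed.

Lemma npast_leq i i' : (i' <= i)%N -> (npast M i' <= npast M i)%N.
Proof.
rewrite leq_eqVlt => /orP[/eqP/val_inj -> //|/npast_lt].
exact/leq_trans/leq_addr.
Qed.

Lemma asset_posE i (j : 'I_(nasset M i)) : asset_pos j = (npast M i + j)%N :> nat.
Proof. exact: tagnat.RankEsum. Qed.

Lemma asset_pos_lt i i' (j : 'I_(nasset M i)) (j' : 'I_(nasset M i')) :
  (i' < i)%N -> asset_pos j' != asset_pos j.
Proof.
move=> /npast_lt h; apply/eqP => /(congr1 (@nat_of_ord _)).
rewrite !asset_posE => E; have := leq_trans (ltn_ord j') (nasset_le i').
by rewrite -(ltn_add2l (npast M i')) E => /leq_trans/(_ h); rewrite ltnNge leq_addr.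
Qed.

Lemma asset_pos_inj i : injective (@asset_pos R M i).
Proof.
move=> j j' /(congr1 (@nat_of_ord _)); rewrite !asset_posE => /eqP.
by rewrite eqn_add2l => /eqP/val_inj.
Qed.

(** Information up to time [i] involves only coordinates strictly before that time, while
    [asset_pos j] belongs to time [i]. *)
Lemma info_eq i i' (j : 'I_(nasset M i)) z z' : (i' <= i)%N ->
  (forall l, l != asset_pos j -> tnth z l = tnth z' l) -> info i' z = info i' z'.
Proof.
move=> ii zz; rewrite /info; congr (tuple_of_row (_ *m _)).
apply/rowP => l; rewrite !mxE; apply: zz.
apply/eqP => /(congr1 (@nat_of_ord _)); rewrite asset_posE => /= E.
have := leq_trans (ltn_ord l) (npast_leq ii).
by rewrite E ltnNge leq_addr.
Qed.

Definition feedback_term (g : feedback M) i (j : 'I_(nasset M i)) z : R :=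
  g i j (info i z) * tnth z (asset_pos j).

(* Backward induction on time: flipping the sign of the last increment [p]
   changes only the term it multiplies, once the later terms are removed. *)
Lemma feedback_term_closed (g : feedback M)
    (C : ((nvars M).-tuple R -> R) -> Prop) :
  (forall f h, C f -> C h -> C (f \- h)) ->
  (forall a f, C f -> C (fun z => a * f z)) ->
  (forall f p, C f -> C (f \o refl_tuple p (flip_row p))) ->
  C (feedback_wealth g) ->
  forall i (j : 'I_(nasset M i)), C (@feedback_term g i j).
Proof.
move=> CB CZ Cflip CV.
have C0 : C (fun=> 0).
  have -> : (fun=> 0) = feedback_wealth g \- feedback_wealth g.
    by apply/funext => z; rewrite /= subrr.
  exact: CB.
have CD f h : C f -> C h -> C (f \+ h).
  move=> Cf Ch; have -> : f \+ h = f \- (fun z => -1 * h z).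
    by apply/funext => z /=; ring.
  by apply: CB => //; exact: CZ.
have Csum (I : Type) (s : seq I) (F : I -> (nvars M).-tuple R -> R) :
    (forall j, C (F j)) -> C (fun z => \sum_(j <- s) F j z).
  move=> CF; elim: s => [|j s IH]; first by under eq_fun do rewrite big_nil.
  by under eq_fun do rewrite big_cons; exact: CD.
pose W k z := \sum_(i < horizon M | (i < k)%N) \sum_j @feedback_term g i j z.
have step i : C (W i.+1) -> (forall j, C (@feedback_term g i j)) /\ C (W i).
  move=> CW.
  have Ct j : C (@feedback_term g i j).
    pose p := asset_pos j.
    have -> : @feedback_term g i j =
        (fun z => 2^-1 * (W i.+1 \- (W i.+1 \o refl_tuple p (flip_row p))) z).
      apply/funext => z /=; rewrite /W -sumrB (bigD1 i) //= [X in _ + X]big1.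
        rewrite addr0 -sumrB (bigD1 j) //= [X in _ + X]big1.
          rewrite addr0 /feedback_term tnth_flip eqxx.
          rewrite (@info_eq i i j z (refl_tuple p (flip_row p) z)) //; last first.
            by move=> l /negPf lp; rewrite tnth_flip lp.
          by field.
        move=> j' jj; rewrite /feedback_term tnth_flip (inj_eq (@asset_pos_inj i)).
        rewrite (negPf jj) (@info_eq i i j z (refl_tuple p (flip_row p) z)) ?subrr //.
        by move=> l /negPf lp; rewrite tnth_flip lp.
      move=> i' /andP[ii' i'i]; have ii : (i' < i)%N.
        by rewrite ltn_neqAle -ltnS ii' andbT.
      rewrite -sumrB big1 // => j' _; rewrite /feedback_term tnth_flip.
      rewrite (negPf (asset_pos_lt j j' ii)).
      rewrite (@info_eq i i' j z (refl_tuple p (flip_row p) z) (ltnW ii)) ?subrr //.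
      by move=> l /negPf lp; rewrite tnth_flip lp.
    by apply: CZ; apply: CB => //; exact: Cflip.
  split=> //.
  have -> : W i = W i.+1 \- (fun z => \sum_j @feedback_term g i j z).
    apply/funext => z /=; rewrite /W [X in _ = X - _](bigD1 i) //=.
    rewrite [X in X - _]addrC addrK; apply: eq_bigl => k.
    by rewrite ltnS ltn_neqAle andbC.
  by apply: CB => //; exact: Csum.
(* The descent in time is an ordinary induction on the number [m] of final times already removed. *)
have CWm m : (m <= horizon M)%N -> C (W (horizon M - m)%N).
  elim: m => [_|m IH mN].
    have -> : W (horizon M - 0)%N = feedback_wealth g; last exact: CV.
    apply/funext => z; rewrite /W subn0 /feedback_wealth.
    by apply: eq_bigl => k; rewrite ltn_ord.
  have lt : (horizon M - m.+1 < horizon M)%N by lia.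
  have := (step (Ordinal lt)); rewrite /=.
  have -> : (horizon M - m.+1).+1 = (horizon M - m)%N by lia.
  by move=> /(_ (IH (ltnW mN))) [].
move=> i j; apply: (step i _).1.
have -> : i.+1 = (horizon M - (horizon M - i.+1))%N by have := ltn_ord i; lia.
by apply: CWm; exact: leq_subr.
Qed.

End market_positions.

(** * The space of matrices as the space of linear strategies *)

Section Dspace.
Context {R : realType} (M : market R).
Implicit Types (i : 'I_(horizon M)) (z : (nvars M).-tuple R).
Implicit Types (G Q : 'M[R]_(nvars M)).

Definition coef_family : Type :=
  forall i, 'I_(nasset M i) -> 'I_(ninfo M i) -> R.

Definition Dmx_comb (c : coef_family) : 'M[R]_(nvars M) :=
  \sum_(i < horizon M) \sum_(j < nasset M i) \sum_(k < ninfo M i)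
    c i j k *: Dmx j k.

(** The coefficients become those of a linear strategy. They are chosen, not determined by [G],
    because the matrices [Dmx j k] may be linearly dependent. *)
Lemma memv_Dspace G : G \in Dspace M -> exists c, G = Dmx_comb c.
Proof.
move=> /memv_sumP[u uD ->].
suff H i : exists c : 'I_(nasset M i) -> 'I_(ninfo M i) -> R,
    u i = \sum_j \sum_k c j k *: Dmx j k.
  exists (fun i => sval (cid (H i))).
  by apply: eq_bigr => i _; exact: svalP (cid (H i)).
have /memv_sumP[v vD ->] := uD i isT.
suff {}H j : exists c : 'I_(ninfo M i) -> R, v j = \sum_k c k *: Dmx j k.
  exists (fun j => sval (cid (H j))).
  by apply: eq_bigr => j _; exact: svalP (cid (H j)).
have /memv_sumP[w wD ->] := vD j isT.
have {}H k : exists c : R, w k = c *: Dmx j k by apply/vlineP; exact: wD.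
exists (fun k => sval (cid (H k))).
by apply: eq_bigr => k _; exact: svalP (cid (H k)).
Qed.

Lemma info_coef_asset_pos i (j : 'I_(nasset M i)) (k : 'I_(ninfo M i)) :
  info_coef k (asset_pos j) 0 = 0.
Proof.
rewrite mxE big1 // => h /eqP E; have := ltn_ord h.
by rewrite (E : h = asset_pos j :> nat) asset_posE ltnNge leq_addr.
Qed.

(** Up to the factor -2 the trace is the covariance under [Q] of an asset increment and a component
    of the information it is traded on; orthogonality to [Dspace M] says that these are
    uncorrelated. *)
Lemma mxtrace_mul_Dmx Q i (j : 'I_(nasset M i)) (k : 'I_(ninfo M i)) : symmx Q ->
  \tr (Q *m Dmx j k) = - 2 * (row (asset_pos j) Q *m info_coef k) 0 0.
Proof.
move=> Qs; rewrite /Dmx mulmxN linearN /= mulmxDr linearD /= !mulmxA.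
have tr1 (A : 'M[R]_1) : \tr A = A 0 0 by rewrite /mxtrace big_ord1.
have -> : \tr (Q *m info_coef k *m delta_mx 0 (asset_pos j)) =
    (row (asset_pos j) Q *m info_coef k) 0 0.
  by rewrite mxtrace_mulC tr1 mulmxA -rowE.
have -> : \tr (Q *m delta_mx (asset_pos j) 0 *m (info_coef k)^T) =
    (row (asset_pos j) Q *m info_coef k) 0 0.
  by rewrite -mxtrace_tr !trmx_mul trmxK Qs trmx_delta mxtrace_mulC tr1 -rowE.
ring.
Qed.

(** The trace vanishes because the information at a time has coefficient 0 at the asset positions of
    that time. *)
Lemma Dspace_symmx_trace G : G \in Dspace M -> symmx G /\ \tr G = 0.
Proof.
move=> /memv_Dspace[c ->]; split.
  rewrite /symmx /Dmx_comb !linear_sum; apply: eq_bigr => i _.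
  rewrite linear_sum; apply: eq_bigr => j _.
  rewrite linear_sum; apply: eq_bigr => k _.
  by rewrite linearZ /= Dmx_sym.
rewrite /Dmx_comb !linear_sum big1 // => i _; rewrite linear_sum big1 // => j _.
rewrite linear_sum big1 // => k _; rewrite linearZ /= -[Dmx j k]mul1mx.
rewrite mxtrace_mul_Dmx; last exact: trmx1.
by rewrite -row_mul mul1mx mxE info_coef_asset_pos !mulr0.
Qed.

Definition linear_strategy (c : coef_family) : feedback M :=
  fun i j y => \sum_k c i j k * tnth y k.

Lemma feedback_wealth_linear c z : feedback_wealth (linear_strategy c) z =
  - (2^-1 * quadform (Dmx_comb c) (row_of_tuple z)).
Proof.
have qs I (r : seq I) (F : I -> 'M[R]_(nvars M)) v :
    quadform (\sum_(i <- r) F i) v = \sum_(i <- r) quadform (F i) v.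
  elim: r => [|i r IH]; first by rewrite !big_nil /quadform mulmx0 mul0mx mxE.
  by rewrite !big_cons quadformD IH.
rewrite /feedback_wealth /Dmx_comb qs mulr_sumr -sumrN; apply: eq_bigr => i _.
rewrite qs mulr_sumr -sumrN; apply: eq_bigr => j _.
rewrite qs mulr_sumr -sumrN mulr_suml; apply: eq_bigr => k _.
by rewrite -mulrA DmxE quadformZ; ring.
Qed.

Lemma measurable_info i : measurable_fun setT (@info R M i).
Proof.
apply: measurable_tuple_of_row => k.
rewrite (_ : (fun x => _) = (fun x : (nvars M).-tuple R => \sum_l
    tnth x (widen_ord (npast_le i) l) * infomx M i l k)); last first.
  by apply/funext => x; rewrite mxE; apply: eq_bigr => l _; rewrite mxE.
by apply: measurable_sum => l; apply: measurable_funM => //; exact: measurable_tnth.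
Qed.

Lemma measurable_feedback_term g i (j : 'I_(nasset M i)) :
  measurable_feedback g -> measurable_fun setT (@feedback_term R M g i j).
Proof.
move=> mg; apply: measurable_funM; last exact: measurable_tnth.
by apply: measurableT_comp; [exact: mg|exact: measurable_info].
Qed.

Lemma measurable_feedback_wealth g :
  measurable_feedback g -> measurable_fun setT (@feedback_wealth R M g).
Proof.
move=> mg; apply: measurable_sum => i; apply: measurable_sum => j.
exact: measurable_feedback_term.
Qed.

Lemma measurable_linear_strategy c : measurable_feedback (linear_strategy c).
Proof. by move=> i j; exact: measurable_fun_sum_tnth. Qed.

Lemma integrable_linear_strategy c : integrable_feedback (linear_strategy c).
Proof.
move=> S mu Sp Smu; apply/(gauss_law_integrableP Sp Smu).
  by apply: measurable_feedback_wealth; exact: measurable_linear_strategy.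
have := gauss_integrableZ (- 2^-1)
  (gauss_integrable_quadform (Dmx_comb c) (posdef_inv Sp)).
congr (gauss_integrable _ _); apply/funext => z.
by rewrite feedback_wealth_linear mulNr.
Qed.

(* The covariance matrix [Q] makes the multiplier of each term independent of
   the information it is based on: the [Q]-orthogonal reflection at the
   asset coordinate fixes the information, preserves the law N(0, Q) and
   changes the sign of the term. Integrability of the separate terms follows
   from the integrability of the wealth under N(0, I / c). *)
Lemma feedback_wealth_centered g Q : posdefmx Q -> Dperp Q ->
  measurable_feedback g -> integrable_feedback g ->
  gauss_integrable (invmx Q) (@feedback_wealth R M g) /\
  (\int[lebesgue_tuple R (nvars M)]_z
     (feedback_wealth g z * gaussexp (invmx Q) z)%:E = 0)%E.
Proof.
move=> Qp [Qs Qperp] mg ig; have mW := measurable_feedback_wealth mg.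
have [c c0 Qc] := gaussexp_coercive (posdef_inv Qp).
have cW : gauss_integrable c%:M (@feedback_wealth R M g).
  have Sp : posdefmx (c^-1%:M : 'M[R]_(nvars M)).
    by rewrite -scalemx1; apply: posdefZ; [rewrite invr_gt0|exact: posdef1].
  have law : gauss_law c^-1%:M (gauss_prob Sp) by apply/(gauss_lawP Sp).
  have := ig _ (gauss_prob Sp) Sp law; move/(gauss_law_integrableP Sp law mW).
  by rewrite invmx_scalar invrK.
have ct i (j : 'I_(nasset M i)) : gauss_integrable c%:M (@feedback_term R M g i j).
  apply: feedback_term_closed cW i j.
  - exact: gauss_integrableB.
  - exact: gauss_integrableZ.
  - by move=> f p; exact: gauss_integrable_flip.
have tQ i (j : 'I_(nasset M i)) : gauss_integrable (invmx Q) (@feedback_term R M g i j).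
  by apply: (gauss_integrable_le (c := 1)) (ct i j) => z; rewrite mul1r.
have t0 i (j : 'I_(nasset M i)) : (\int[lebesgue_tuple R (nvars M)]_z
     (feedback_term g j z * gaussexp (invmx Q) z)%:E = 0)%E.
  set p := asset_pos j; set v := - (2 / Q p p) *: row p Q.
  have Qpp : Q p p != 0.
    rewrite -bilform_delta gt_eqF //; apply: Qp.2.
    by apply/eqP => /matrixP/(_ 0 p)/eqP; rewrite !mxE !eqxx oner_eq0.
  have vp : v 0 p = - 2 by rewrite !mxE mulNr divfK.
  apply: (integral_refl_odd vp (tQ i j).2) => z.
  rewrite gaussexp_refl // -EFinN -mulNr; congr (_ * _)%:E.
  rewrite /feedback_term.
  (* The reflection adds a multiple of [row p Q], which [info_coef k] annihilates since [Q] is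
     orthogonal to [Dmx j k]. *)
  have -> : info i (refl_tuple p v z) = info i z.
    apply: eq_from_tnth => k; rewrite !info_coefE /refl_tuple tuple_of_rowK.
    rewrite mulmxDl -!scalemxAl mxE [X in _ + X](_ : _ = 0) ?addr0 //.
    have Dm : Dmx j k \in Dspace M.
      apply: (subvP (sumv_sup i isT (sumv_sup j isT (sumv_sup k isT (subvv _))))).
      exact: memv_line.
    have := Qperp _ Dm; rewrite mxtrace_mul_Dmx // => /eqP.
    rewrite mulf_eq0 oppr_eq0 pnatr_eq0 /= => /eqP h.
    by rewrite mxE [X in _ * X]mxE h !mulr0.
  by rewrite tnth_mktuple !mxE mulNr divfK //; ring.
have E z : (feedback_wealth g z * gaussexp (invmx Q) z)%:E =
    (\sum_(i < horizon M) \sum_(j < nasset M i)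
       (feedback_term g j z * gaussexp (invmx Q) z)%:E)%E.
  under [RHS]eq_bigr do rewrite sumEFin.
  rewrite sumEFin; congr EFin; rewrite /feedback_wealth mulr_suml; apply: eq_bigr => i _.
  by rewrite mulr_suml.
have iE : (lebesgue_tuple R (nvars M)).-integrable setT
    (fun z => (feedback_wealth g z * gaussexp (invmx Q) z)%:E).
  by apply: (gauss_integrable_le (c := 1) _ cW).2 => z; rewrite mul1r.
split=> //.
under eq_integral do rewrite E.
have mt i (j : 'I_(nasset M i)) := (tQ i j).2.
rewrite integral_sum //; last first.
  move=> i; apply: (@integrable_sum _ _ _ _ _ _ _ _ _ (fun j z =>
     (feedback_term g j z * gaussexp (invmx Q) z)%:E)) => // j _; exact: mt.
apply: big1 => i _; rewrite integral_sum //; apply: big1 => j _; exact: t0.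
Qed.

End Dspace.

(** * Optimality *)

Section exponential_deviation.
Context {R : realType} {n : nat}.
Local Notation L := (lebesgue_tuple R n).
Variables (A : 'M[R]_n) (U : n.-tuple R -> R).
Hypotheses (Ap : posdefmx A) (iU : gauss_integrable A U).
Hypothesis U0 : (\int[L]_z (U z * gaussexp A z)%:E = 0)%E.

Let J := Num.sqrt ((2 * pi) ^+ n / \det A).

(** The deviation [D] of [expR (- U)] from its tangent [1 - U] is nonnegative, and since [U] is
    centered its integral is the gap between the two sides. If the gap is zero, [D] vanishes almost
    everywhere, which by strict convexity forces [U] to vanish there. *)
Lemma integral_expR_centered :
  (J%:E <= \int[L]_z (expR (- U z) * gaussexp A z)%:E)%E /\
  ((\int[L]_z (expR (- U z) * gaussexp A z)%:E <= J%:E)%E -> lebesgue_null U).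
Proof.
have [mU _] := iU.
have mE : measurable_fun setT (fun z => expR (- U z)).
  by apply: measurableT_comp => //; exact: measurable_funN.
(* With an infinite integral the bound is trivial and the premise of the equality case fails;
   otherwise [expR (- U)] is integrable and integrals may be subtracted. *)
have [Ey|Efin] := eqVneq (\int[L]_z (expR (- U z) * gaussexp A z)%:E)%E +oo%E.
  by rewrite Ey leey; split.
have iE : gauss_integrable A (fun z => expR (- U z)).
  split=> //; apply/gauss_integrableP => //.
  under eq_integral do rewrite ger0_norm ?expR_ge0 //.
  by rewrite ltey.
have i1 := gauss_integrable1 Ap.
have I1 : (\int[L]_z (1 * gaussexp A z)%:E = J%:E)%E.
  by under eq_integral do rewrite mul1r; exact: integral_gaussexp.
pose D z := expR (- U z) - (1 - U z).
have D0 z : 0 <= D z by rewrite subr_ge0; exact: expR_ge1Dx.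
have iD : gauss_integrable A D.
  by apply: gauss_integrableB => //; exact: gauss_integrableB.
have ID : (\int[L]_z (D z * gaussexp A z)%:E =
    \int[L]_z (expR (- U z) * gaussexp A z)%:E - J%:E)%E.
  have i2 := integrableB measurableT i1.2 iU.2.
  have := integralB measurableT iE.2 i2; rewrite (integralB measurableT i1.2 iU.2).
  rewrite U0 sube0 I1 => <-; apply: eq_integral => z _ /=.
  by rewrite -!EFinB /D; congr EFin; ring.
have ID0 : (0 <= \int[L]_z (D z * gaussexp A z)%:E)%E.
  by apply: integral_ge0 => z _; rewrite lee_fin mulr_ge0 ?gaussexp_ge0.
split; first by move: ID0; rewrite ID sube_ge0.
move=> EJ; apply/lebesgue_null_ae => //.
have mDg : measurable_fun setT (fun z => D z * gaussexp A z).
  apply: measurable_funM; [exact: iD.1|exact: measurable_gaussexp].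
have /(lebesgue_null_ae mDg) : lebesgue_null (fun z => D z * gaussexp A z).
  split=> //; under eq_integral => z _.
    rewrite gee0_abs ?lee_fin ?mulr_ge0 ?gaussexp_ge0 //; over.
  apply/eqP; rewrite eq_le ID0 andbT ID.
  by rewrite sube_le0.
apply: filterS => z /eqP; rewrite mulf_eq0 (gt_eqF (gaussexp_gt0 _ _)) orbF.
rewrite /D subr_eq0 => /eqP h; apply/eqP; rewrite -oppr_eq0; apply/negPn/negP.
by move=> /expR_gt1Dx; rewrite h ltxx.
Qed.

End exponential_deviation.

(** * Passage from the probability space to the law of Z *)

Section strategies.
Context {R : realType} (M : market R) (d : measure_display)
  (T : measurableType d) (P : probability T R) (X : factors M P).
Variable S : 'M[R]_(nvars M).
Hypotheses (Sp : posdefmx S) (Zlaw : gauss_law S (pushforward P (Zvec X))).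
Local Notation L := (lebesgue_tuple R (nvars M)).

Lemma measurable_Zvec : measurable_fun setT (Zvec X).
Proof.
apply/measurable_fun_tnthP => k.
rewrite (_ : _ \o _ = X (tagnat.sig2 k)); first exact: measurable_funP.
by apply/funext => w /=; rewrite tnth_mktuple.
Qed.

Lemma ge0_integral_Zvec (f : (nvars M).-tuple R -> R) :
  measurable_fun setT f -> (forall z, 0 <= f z) ->
  (\int[P]_w (f (Zvec X w))%:E = \int[L]_z (f z * gauss_pdf S z)%:E)%E.
Proof.
move=> mf f0; have mf' : measurable_fun setT (EFin \o f) by exact/measurable_EFinP.
have := @ge0_integral_pushforward _ _ _ _ _ _ measurable_Zvec P setT (EFin \o f)
  measurableT mf' (fun y _ => f0 y).
rewrite preimage_setT => <-.
transitivity (\int[gauss_prob Sp]_z (f z)%:E)%E.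
  apply: eq_measure_integral => [|mZ A mA _]; first exact: measurable_Zvec.
  exact: ((gauss_lawP Sp _).1 Zlaw _ mA).
by rewrite (ge0_integral_gauss_law Sp) //; apply/(gauss_lawP Sp).
Qed.

(** The law of Z has a density, so sets that are null for Lebesgue measure are null for it. *)
Lemma ae_Zvec (f : (nvars M).-tuple R -> R) : lebesgue_null f ->
  {ae P, forall w, f (Zvec X w) = 0}.
Proof.
move=> nf; have mf := nf.1.
have mN : measurable [set z | f z != 0].
  rewrite (_ : mkset _ = f @^-1` [set~ 0]); last first.
    by apply/seteqP; split=> z /= /eqP.
  by rewrite -[X in measurable X]setTI; apply: mf => //; exact: measurableC.
exists (Zvec X @^-1` [set z | f z != 0]); split.
- by rewrite -[X in measurable X]setTI; exact: measurable_Zvec.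
- rewrite -(gauss_prob_null Sp nf); exact: ((gauss_lawP Sp _).1 Zlaw _ mN).
- by move=> w /= /eqP.
Qed.

(** The integrand has constant sign, so the identity also covers strategies of utility minus
    infinity. *)
Lemma utilityE (gam : strategy M T) (g : feedback M) :
  generated_by X g gam -> measurable_feedback g ->
  utility X gam = (- \int[L]_z (expR (- feedback_wealth g z) * gauss_pdf S z)%:E)%E.
Proof.
move=> gg mg; rewrite /utility unlock.
rewrite -(ge0_integral_Zvec (f := fun z => expR (- feedback_wealth g z))); last 2 first.
- apply: measurableT_comp => //; apply: measurable_funN.
  exact: measurable_feedback_wealth.
- by move=> z; exact: expR_ge0.
rewrite -integral_ge0N; last by move=> w _; rewrite lee_fin expR_ge0.
by apply: eq_integral => w _; rewrite (wealth_feedback gg) EFinN.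
Qed.

End strategies.

(** * Change of measure by the linear strategy, and the equality case *)

Section optimality.
Context {R : realType} (M : market R).
Local Notation n := (nvars M).
Local Notation L := (lebesgue_tuple R n).
Variables (S Q : 'M[R]_n) (c : coef_family M).
Hypotheses (Sp : posdefmx S) (Qp : posdefmx Q) (QD : Dperp Q).
Hypothesis SQ : invmx S = invmx Q + Dmx_comb c.

Definition excess (g : feedback M) : n.-tuple R -> R :=
  feedback_wealth g \- feedback_wealth (linear_strategy c).

Let K := Num.sqrt ((2 * pi) ^+ n * \det S).
Let J := Num.sqrt ((2 * pi) ^+ n / \det (invmx Q)).

Let K0 : 0 < K^-1. Proof. by rewrite invr_gt0; exact: gauss_norm_gt0. Qed.

(** Splitting [invmx S] factors out [gaussexp (Dmx_comb c)], the exponential of the linear wealth;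
    it combines with [expR (- feedback_wealth g z)] to the exponential of minus the excess, and the
    kernel of N(0, Q) is left. *)
Lemma integral_expR_wealth (g : feedback M) : measurable_feedback g ->
  (\int[L]_z (expR (- feedback_wealth g z) * gauss_pdf S z)%:E =
   K^-1%:E * \int[L]_z (expR (- excess g z) * gaussexp (invmx Q) z)%:E)%E.
Proof.
move=> mg.
have mU : measurable_fun setT (fun z => (expR (- excess g z) * gaussexp (invmx Q) z)%:E).
  apply/measurable_EFinP; apply: measurable_funM; last exact: measurable_gaussexp.
  apply: measurableT_comp => //; apply: measurable_funN; apply: measurable_funB.
    exact: measurable_feedback_wealth.
  by apply: measurable_feedback_wealth; exact: measurable_linear_strategy.
have U0 z : (0 <= (expR (- excess g z) * gaussexp (invmx Q) z)%:E)%E.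
  by rewrite lee_fin mulr_ge0 ?expR_ge0 ?gaussexp_ge0.
rewrite -(ge0_integralZl L measurableT mU (fun z _ => U0 z)); last first.
  by rewrite lee_fin ltW.
apply: eq_integral => z _; rewrite gauss_pdfE -/K SQ gaussexpD -EFinM /excess /=.
rewrite opprB expRD feedback_wealth_linear; congr EFin.
rewrite -/(gaussexp (Dmx_comb c) z); ring.
Qed.

Lemma gauss_norm_ratio : K^-1 * J = Num.sqrt (\det Q / \det S).
Proof.
have p0 : 0 < (2 * pi) ^+ n :> R by rewrite exprn_gt0 // mulr_gt0 // pi_gt0.
have dS := posdef_det Sp; have dQ := posdef_det Qp.
rewrite /K /J det_inv invrK !sqrtrM ?ltW // sqrtrV; last exact: ltW.
by field; rewrite !gt_eqF ?sqrtr_gt0.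
Qed.

Lemma excess_centered (g : feedback M) :
  measurable_feedback g -> integrable_feedback g ->
  gauss_integrable (invmx Q) (excess g) /\
  (\int[L]_z (excess g z * gaussexp (invmx Q) z)%:E = 0)%E.
Proof.
move=> mg ig; have [i1 I1] := feedback_wealth_centered Qp QD mg ig.
have [i2 I2] := feedback_wealth_centered Qp QD
  (@measurable_linear_strategy R M c) (@integrable_linear_strategy R M c).
split; first exact: gauss_integrableB.
have := integralB measurableT i1.2 i2.2; rewrite I1 I2 sube0 => <-.
by apply: eq_integral => z _; rewrite /= -EFinB -mulrBl.
Qed.

Lemma excess_optimal (g : feedback M) :
  measurable_feedback g -> integrable_feedback g ->
  ((Num.sqrt (\det Q / \det S))%:E <=
     \int[L]_z (expR (- feedback_wealth g z) * gauss_pdf S z)%:E)%E /\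
  ((\int[L]_z (expR (- feedback_wealth g z) * gauss_pdf S z)%:E <=
     (Num.sqrt (\det Q / \det S))%:E)%E -> lebesgue_null (excess g)).
Proof.
move=> mg ig; have [iU U0] := excess_centered mg ig.
have [h1 h2] := integral_expR_centered (posdef_inv Qp) iU U0.
rewrite integral_expR_wealth // -gauss_norm_ratio EFinM.
by rewrite !lee_pmul2l ?lte_fin.
Qed.

Lemma integral_expR_linear_strategy :
  (\int[L]_z (expR (- feedback_wealth (linear_strategy c) z) * gauss_pdf S z)%:E =
  (Num.sqrt (\det Q / \det S))%:E)%E.
Proof.
rewrite integral_expR_wealth; last exact: measurable_linear_strategy.
rewrite -gauss_norm_ratio EFinM; congr (_ * _)%E.
rewrite -integral_gaussexp; last exact: posdef_inv.
by apply: eq_integral => z _; rewrite /excess /= subrr oppr0 expR0 mul1r.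
Qed.

(* Each term [h(info z) * z_p] of the excess wealth vanishes almost everywhere;
   translating [z_p] by 1 and subtracting gives [h(info z) = 0]. *)
Lemma lebesgue_null_excess (g : feedback M) : lebesgue_null (excess g) ->
  forall i (j : 'I_(nasset M i)),
  lebesgue_null (fun z => g i j (info i z) - linear_strategy c j (info i z)).
Proof.
move=> gn i j; pose h : feedback M := fun i j y => g i j y - linear_strategy c j y.
have hE : excess g = feedback_wealth h.
  apply/funext => z; rewrite /excess /feedback_wealth /= -sumrB.
  by apply: eq_bigr => k _; rewrite -sumrB; apply: eq_bigr => l _; rewrite -mulrBl.
have hn : lebesgue_null (@feedback_term R M h i j).
  apply: feedback_term_closed; last by rewrite -hE.
  - exact: lebesgue_nullB.
  - exact: lebesgue_nullZ.
  - by move=> f p; apply: lebesgue_null_refl; exact: flip_rowE.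
have := lebesgue_nullB (lebesgue_null_translate (delta_mx 0 (asset_pos j)) hn) hn.
congr lebesgue_null; apply/funext => z /=; rewrite /feedback_term.
rewrite (@info_eq _ _ i i j (tuple_of_row _) z) //; last first.
  by move=> l lj; rewrite tnth_mktuple !mxE (negPf lj) addr0.
by rewrite tnth_mktuple !mxE !eqxx /h mulrDr addrAC subrr add0r mulr1.
Qed.

End optimality.

Theorem proposition4p1 (R : realType) (M : market R)
  (d : measure_display) (T : measurableType d) (P : probability T R)
  (X : factors M P) (S : 'M[R]_(nvars M))
  (S_posdef : posdefmx S)
  (Z_gauss : gauss_law S (pushforward P (Zvec X))) :
  (exists! QG : 'M[R]_(nvars M) * 'M[R]_(nvars M),
     decomposition (invmx S) QG.1 QG.2) /\
  (forall Q G : 'M[R]_(nvars M), decomposition (invmx S) Q G ->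
     exists gam : strategy M T,
       [/\ maximizer X gam,
           forall gam', maximizer X gam' -> ae_eq_strategy P gam' gam,
           linear_admissible X gam,
           {ae P, forall w, wealth X gam w =
              - (2^-1 * quadform G (row_of_tuple (Zvec X w)))}
         & utility X gam = (- Num.sqrt (\det Q / \det S))%:E]).
Proof.
split.
  have [G [GD Ap Atr]] :=
    posdef_trace_decomposition (posdef_inv S_posdef) (@Dspace_symmx_trace R M).
  (* The trace condition concerns the inverse of [invmx S - G], so this inverse is the required
     [Q]. *)
  exists (invmx (invmx S - G), G); split.
    split=> /=; first by rewrite invmxK subrK.
    - exact: posdef_inv.
    - by split; [exact: (posdef_inv Ap).1|exact: Atr].
    - exact: GD.
  move=> [Q' G'] [/= E' Qp' [_ D'] GD'].
  have [|-> ->//] := @posdef_trace_decomposition_uniq R _ (Dspace M) (invmx S)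
    (invmx (invmx S - G)) G Q' G' _ E' (posdef_inv Ap) Qp' GD GD' Atr D'.
  by rewrite invmxK subrK.
(* The coefficients of [G] in the spanning family are used as those of the optimal linear
   strategy. *)
move=> Q G [SQ Qp QD /memv_Dspace[c Gc]]; rewrite {G}Gc in SQ *.
pose gam : strategy M T := fun i j w => linear_strategy c j (Yvec X i w).
have gg : generated_by X (linear_strategy c) gam by [].
have mc := @measurable_linear_strategy R M c.
have adm : admissible X gam.
  by exists (linear_strategy c); split=> //; exact: integrable_linear_strategy.
have Ug : utility X gam = (- Num.sqrt (\det Q / \det S))%:E.
  by rewrite (utilityE S_posdef Z_gauss gg) // (integral_expR_linear_strategy S_posdef Qp SQ).
exists gam; split.
- split=> // gam' [g [mg gg' ig]].
  rewrite Ug (utilityE S_posdef Z_gauss gg') // EFinN leeN2.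
  exact: (excess_optimal S_posdef Qp QD SQ mg ig).1.
(* Comparison of another maximizer with [gam] puts its exponential integral at or below the optimal
   value. The equality case then makes its excess null, which determines each position
   separately. *)
- move=> gam' [[g [mg gg' ig]] /(_ _ adm)].
  rewrite Ug (utilityE S_posdef Z_gauss gg') // EFinN leeN2.
  move=> /((excess_optimal S_posdef Qp QD SQ mg ig).2) gn i j.
  have := ae_Zvec S_posdef Z_gauss (lebesgue_null_excess gn j).
  by apply: filterS => w /eqP; rewrite subr_eq0 => /eqP h; rewrite gg' /gam /Yvec h.
- by split=> //; exists (linear_strategy c); split=> // i j; exists (c i j).
- by apply: aeW => w; rewrite (wealth_feedback gg) feedback_wealth_linear.
- exact: Ug.
Qed.
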